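(* Let $\{\rho_\varepsilon\}_{\varepsilon>0}\subset L^1(\mathbb R^n)$ be a family of non-negative radial functions with $\|\rho_\varepsilon\|_{L^1(\mathbb R^n)}=1$ and $\lim_{\varepsilon\to0^+}\|\rho_\varepsilon\|_{L^1(\mathbb R^n\setminus B_\delta)}=0$ for all $\delta>0$. Let $1\le p\le\infty$ and let $\varphi\in\mathscr D(\mathbb R^n;V)$. Then $$\mathfrak A_{\rho_\varepsilon}\varphi\to\mathcal A\varphi\quad\text{in }L^p\text{ as }\varepsilon\to0^+.$$ If moreover $\{\rho_\varepsilon\}_\varepsilon$ is uniformly compactly supported, then also $\mathfrak A_{\rho_\varepsilon}\varphi\to\mathcal A\varphi$ in $\mathscr D(\mathbb R^n;W)$ as $\varepsilon\to0^+$.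
   Context: $\mathscr D=C_c^\infty$ with its usual topology. $V,W$ are finite-dimensional inner product spaces, $A_1,\dots,A_n\in\mathrm{Hom}(V,W)$, $\mathcal A=\sum_{i=1}^nA_i\partial_i$ with symbol $\mathbb A(\xi)=\sum_iA_i\xi_i$. For a nonnegative integrable radial Borel function $\rho$ and $u\in\mathscr D(\mathbb R^n;V)$, $$\mathfrak A_\rho u(x)=\lim_{\delta\to0^+}n\int_{\mathbb R^n\setminus B_\delta}\mathbb A\left(\frac{\xi}{|\xi|}\right)\left[\frac{u(x+\xi)-u(x)}{|\xi|}\right]\rho(\xi)\,d\xi.$$ ''Uniformly compactly supported'' means that all $\rho_\varepsilon$ vanish outside one common compact set. *)

(* Defs.v *)
From HB Require Import structures.
From mathcomp Require Import all_boot all_order all_algebra.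
From mathcomp Require Import all_classical all_reals all_analysis.

Set Implicit Arguments.
Unset Strict Implicit.
Unset Printing Implicit Defensive.

Import Order.TTheory GRing.Theory Num.Theory.
Import numFieldNormedType.Exports.

Local Open Scope classical_set_scope.
Local Open Scope ring_scope.

(* Finite-dimensional real inner product space, normed by its inner product. *)
HB.mixin Record hasInnerProduct (R : realType) V
    & NormedModule R V := {
  inner : {dot V for @idfun R} ;
  inner_sqr_norm : forall v : V, inner v v = `|v| ^+ 2
}.

#[short(type="finInnerType")]
HB.structure Definition FinInner (R : realType) :=
  { V of NormedModule R V & Vector R V & hasInnerProduct R V }.

(* The library has no sigma-algebra on matrices: take the one generated by the
   coordinate projections. On 'rV[R]_n it is the Borel sigma-algebra of R^n,
   since R^n is second countable. *)
Definition measure_matrix_display : measure_display -> measure_display.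
Proof. exact. Qed.

Section measurable_matrix.
Context {d} {T : measurableType d}.
Variables m n : nat.

Definition mx_cylinder : set (set 'M[T]_(m, n)) :=
  [set B | exists i j (Y : set T),
    measurable Y /\ B = (fun M : 'M[T]_(m, n) => M i j) @^-1` Y].

Let mx_set0 : <<s mx_cylinder >> set0.
Proof. exact: sigma_algebra0. Qed.

Let mx_setC A : <<s mx_cylinder >> A -> <<s mx_cylinder >> (~` A).
Proof. exact: sigma_algebraC. Qed.

Let mx_bigcup (F : _^nat) : (forall i, <<s mx_cylinder >> (F i)) ->
  <<s mx_cylinder >> (\bigcup_i (F i)).
Proof. exact: sigma_algebra_bigcup. Qed.

HB.instance Definition _ := @isMeasurable.Build (measure_matrix_display d)
  'M[T]_(m, n) <<s mx_cylinder >> mx_set0 mx_setC mx_bigcup.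

Lemma measurable_coord i j :
  measurable_fun [set: 'M[T]_(m, n)] (fun M : 'M[T]_(m, n) => M i j).
Proof.
move=> _ Y mY; rewrite setTI; apply: sub_sigma_algebra.
by exists i, j, Y.
Qed.

Lemma measurable_fun_mxP d' (S : measurableType d') (f : S -> 'M[T]_(m, n)) :
  (forall i j, measurable_fun setT (fun s => f s i j)) ->
  measurable_fun setT f.
Proof.
move=> mf; apply: (@measurability _ _ _ _ setT f mx_cylinder) => //.
move=> _ [_ [i [j [Y [mY ->]]]] <-].
by rewrite setTI -comp_preimage -[X in measurable X]setTI; apply: mf.
Qed.

End measurable_matrix.

Section lebesgue_rV.
Variable R : realType.

Definition rV_cons n (p : measurableTypeR R * 'rV[R]_n) : 'rV[R]_(1 + n) :=
  row_mx (p.1)%:M p.2.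

Lemma measurable_rV_cons n : measurable_fun setT (@rV_cons n).
Proof.
apply: measurable_fun_mxP => i j; rewrite ord1.
case: (@split_ordP 1 n j) => k ->.
  rewrite (_ : (fun _ => _) = fst) //.
  by apply/funext => p; rewrite /rV_cons row_mxEl mxE !ord1 eqxx mulr1n.
rewrite (_ : (fun _ => _) = (fun v : 'rV[R]_n => v 0 k) \o snd).
  by apply: measurableT_comp => //; exact: measurable_coord.
by apply/funext => p; rewrite /rV_cons /= row_mxEr.
Qed.

Definition rV_uncons n (v : 'rV[R]_(1 + n)) : measurableTypeR R * 'rV[R]_n :=
  (lsubmx v 0 0, rsubmx v).

Lemma rV_consK n : cancel (@rV_cons n) (@rV_uncons n).
Proof.
by case=> a v; rewrite /rV_uncons /rV_cons row_mxKl row_mxKr mxE eqxx mulr1n.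
Qed.

Lemma rV_unconsK n : cancel (@rV_uncons n) (@rV_cons n).
Proof. by move=> v; rewrite /rV_cons /rV_uncons /= -mx11_scalar hsubmxK. Qed.

Lemma measurable_rV_uncons n : measurable_fun setT (@rV_uncons n).
Proof.
apply/measurable_fun_pair => /=.
  rewrite (_ : (fun _ => _) = (fun v : 'rV[R]_(1 + n) => v 0 (lshift n 0))).
    exact: measurable_coord.
  by apply/funext => v; rewrite mxE.
apply: measurable_fun_mxP => i j; rewrite ord1.
rewrite (_ : (fun _ => _) = (fun v : 'rV[R]_(1 + n) => v 0 (rshift 1 j))).
  exact: measurable_coord.
by apply/funext => v; rewrite mxE.
Qed.

Section step.
Variables (n : nat) (mu : {sigma_finite_measure set 'rV[R]_n -> \bar R}).

Definition lebesgue_step : set 'rV[R]_(1 + n) -> \bar R :=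
  pushforward (@lebesgue_measure R \x mu)%E (@rV_cons n).


Let lebesgue_step0 : lebesgue_step set0 = 0%E.
Proof. by rewrite /lebesgue_step /pushforward preimage_set0 measure0. Qed.

Let lebesgue_step_ge0 A : (0 <= lebesgue_step A)%E.
Proof. by rewrite /lebesgue_step /pushforward measure_ge0. Qed.

Let lebesgue_step_sigma_additive : semi_sigma_additive lebesgue_step.
Proof.
exact: (@measure_semi_sigma_additive _ _ _
  (measure_function_pushforward__canonical__measure_function_Measure
    (@lebesgue_measure R \x mu)%E (@measurable_rV_cons n))).
Qed.

HB.instance Definition _ := isMeasure.Build _ _ _ lebesgue_step
  lebesgue_step0 lebesgue_step_ge0 lebesgue_step_sigma_additive.

Let lebesgue_step_sigma_finite : sigma_finite setT lebesgue_step.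
Proof.
have /sigma_finiteP[F [FT ndF mF]] := sigma_finiteT (@lebesgue_measure R).
have /sigma_finiteP[G [GT ndG mG]] := sigma_finiteT mu.
exists (fun k => (@rV_uncons n) @^-1` (F k `*` G k)).
  apply/esym; rewrite -subTset => v _ /=.
  have [k _ Fk] : (\bigcup_k F k) (rV_uncons v).1 by rewrite -FT.
  have [l _ Gl] : (\bigcup_k G k) (rV_uncons v).2 by rewrite -GT.
  exists (maxn k l) => //; split.
    by move: Fk; exact/subsetPset/ndF/leq_maxl.
  by move: Gl; exact/subsetPset/ndG/leq_maxr.
move=> k; have [mFk Fk] := mF k; have [mGk Gk] := mG k; split.
  rewrite -[X in measurable X]setTI; apply: measurable_rV_uncons => //.
  exact: measurableX.
rewrite /lebesgue_step /pushforward -comp_preimage.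
rewrite (_ : _ \o _ = id); last by apply/funext; exact: rV_consK.
by rewrite preimage_id product_measure1E// lte_mul_pinfty// ge0_fin_numE.
Qed.

HB.instance Definition _ := @Measure_isSigmaFinite.Build _ _ _ lebesgue_step
  lebesgue_step_sigma_finite.

End step.

(* Lebesgue measure on R^n as an iterated product, along R^(1+k) = R x R^k. *)
Fixpoint lebesgue_rV n : {sigma_finite_measure set 'rV[R]_n -> \bar R} :=
  match n with
  | 0 => [the {sigma_finite_measure set 'rV[R]_0 -> \bar R} of
            \d_(0 : 'rV[R]_0)]
  | k.+1 => [the {sigma_finite_measure set 'rV[R]_(1 + k) -> \bar R} of
               lebesgue_step (lebesgue_rV k)]
  end.

End lebesgue_rV.

(* The library norm of 'rV[R]_n is the sup norm; it induces the same topology,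
   but radiality, balls and the kernel below refer to the Euclidean norm. *)
Definition enorm (R : realType) n (x : 'rV[R]_n) : R :=
  Num.sqrt (\sum_(i < n) x 0 i ^+ 2).

Definition eball (R : realType) n (r : R) : set 'rV[R]_n :=
  [set x | enorm x < r].

Definition radial (R : realType) n (rho : 'rV[R]_n -> R) : Prop :=
  forall x y, enorm x = enorm y -> rho x = rho y.

Definition L1norm (R : realType) n (D : set 'rV[R]_n) (f : 'rV[R]_n -> R) :
  \bar R := (\int[lebesgue_rV R n]_(x in D) `|f x|%:E)%E.

(* Integral of a W-valued function, computed in a basis of W; when f is
   integrable the result does not depend on the basis. *)
Definition vintegral (R : realType) n (W : finInnerType R)
    (D : set 'rV[R]_n) (f : 'rV[R]_n -> W) : W :=
  \sum_(k < \dim {:W})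
    (\int[lebesgue_rV R n]_(x in D) coord (vbasis {:W}) k (f x))
      *: (vbasis {:W})`_k.

Section operators.
Variables (R : realType) (n : nat) (V W : finInnerType R).
Variable A : 'I_n -> 'Hom(V, W).

Definition symbol (xi : 'rV[R]_n) : 'Hom(V, W) := \sum_(i < n) xi 0 i *: A i.

Definition diff_op (u : 'rV[R]_n -> V) (x : 'rV[R]_n) : W :=
  \sum_(i < n) A i ('D_(delta_mx 0 i) u x).

Definition nonlocal_trunc (rho : 'rV[R]_n -> R) (u : 'rV[R]_n -> V)
    (x : 'rV[R]_n) (delta : R) : W :=
  n%:R *: vintegral (~` eball delta) (fun xi =>
    rho xi *: symbol ((enorm xi)^-1 *: xi)
                     ((enorm xi)^-1 *: (u (x + xi) - u x))).

Definition nonlocal_op (rho : 'rV[R]_n -> R) (u : 'rV[R]_n -> V)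
    (x : 'rV[R]_n) : W :=
  lim (nonlocal_trunc rho u x delta @[delta --> 0^'+]).

End operators.

Section Lp_convergence.
Variables (R : realType) (n : nat) (W : finInnerType R).
Implicit Types (p : \bar R) (f : 'rV[R]_n -> W).

Definition vLnorm p f : \bar R :=
  Lnorm (lebesgue_rV R n) p (fun x => `|f x|%:E).

Definition in_Lp p f : Prop :=
  (forall U : set W, open U -> measurable (f @^-1` U)) /\
  (vLnorm p f < +oo)%E.

Definition cvg_Lp p (f_ : R -> 'rV[R]_n -> W) f : Prop :=
  [/\ forall eps, 0 < eps -> in_Lp p (f_ eps),
      in_Lp p f &
      vLnorm p (fun x => f_ eps x - f x) @[eps --> 0^'+] --> 0%E].

End Lp_convergence.

Section test_functions.
Variables (R : realType) (n : nat) (W : finInnerType R).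
Implicit Types (f g : 'rV[R]_n -> W) (s : seq 'I_n) (K : set 'rV[R]_n).

Definition iter_partial s f : 'rV[R]_n -> W :=
  foldr (fun i g => 'D_(delta_mx 0 i) g) f s.

Definition smooth f : Prop :=
  forall s, continuous (iter_partial s f) /\
    forall i x, derivable (iter_partial s f) x (delta_mx 0 i).

Definition supp f : set 'rV[R]_n := closure [set x | f x != 0].

Definition test_function f : Prop := smooth f /\ compact (supp f).

Definition test_function_in K f : Prop := test_function f /\ supp f `<=` K.

Definition balanced (U : set ('rV[R]_n -> W)) : Prop :=
  forall (c : R) f, `|c| <= 1 -> U f -> U (c *: f).

(* The space of test functions carries the finest locally convex topology for
   which the inclusions of the Frechet spaces of smooth functions supported in
   a fixed compact set are continuous: a base of neighbourhoods of 0 is given by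
   the convex balanced sets whose trace on each of these subspaces is a
   neighbourhood of 0 for the seminorms max_(|s| <= N) sup |iter_partial s f|. *)
Definition test_nbhs0 (U : set ('rV[R]_n -> W)) : Prop :=
  [/\ U `<=` test_function,
      convex_set (U : set (convex_lmodType ('rV[R]_n -> W))),
      balanced U &
      forall K, compact K -> exists N (r : R), 0 < r /\
        forall f, test_function_in K f ->
          (forall s x, (size s <= N)%N -> `|iter_partial s f x| <= r) -> U f].

Definition cvg_test (f_ : R -> 'rV[R]_n -> W) f : Prop :=
  [/\ forall eps, 0 < eps -> test_function (f_ eps),
      test_function f &
      forall U, test_nbhs0 U -> \forall eps \near 0^'+, U (f_ eps - f)].

End test_functions.

Definition uniformly_compactly_supported (R : realType) n
    (rho : R -> 'rV[R]_n -> R) : Prop :=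
  exists2 K : set 'rV[R]_n, compact K &
    forall eps x, 0 < eps -> ~ K x -> rho eps x = 0.

(* Main.v *)
Require Import Defs.
From HB Require Import structures.
From mathcomp Require Import all_boot all_order all_algebra fingroup perm.
From mathcomp Require Import all_classical all_reals all_analysis.
From mathcomp Require Import measurable_realfun ess_sup_inf ring.

Set Implicit Arguments.
Unset Strict Implicit.
Unset Printing Implicit Defensive.

Import Order.TTheory GRing.Theory Num.Theory.
Import numFieldNormedType.Exports.

Local Open Scope classical_set_scope.
Local Open Scope ring_scope.

(** Expand [phi] in a basis [b_k] of [V], with coordinates [f_k].  The
    integrand of the nonlocal operator becomes a finite sum of scalar kernels
    times the fixed vectors [A_i b_k] ([symbol_lincomb]), so that

      nonlocal_op A rho phi = sum_(i,k) T_i f_k *: A_i b_k,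
      diff_op A phi         = sum_(i,k) d_i f_k *: A_i b_k,

    where, with [omega_i = xi_i / |xi|],

      T_i f (x) = n * int rho(xi) omega_i(xi) |xi|^-1 (f(x + xi) - f(x)) dxi.

    As [f] is Lipschitz, the integrand is at most a constant times [rho]: the
    integral converges absolutely and removing a small ball is harmless in the
    limit ([nonlocal_op_lincomb]).  It remains to compare [T_i] with the partial
    derivative [d_i] on a scalar smooth [f] with bounded derivatives.

    Symmetry.  Lebesgue measure is invariant under sign changes and permutations
    of the coordinates, hence for radial [rho] of mass one
    [n * int rho omega_i omega_j] is 1 if [i = j] and 0 otherwise
    ([second_moment]).  So [d_i f (x)] is the mean that defines [T_i], taken of
    the linear function [xi |-> sum_j xi_j d_j f (x)], and the error
    [T_i f - d_i f] is that same mean taken of the first-order Taylor remainder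
    ([nonlocal_partial_error]).  Divided by [|xi|], the remainder is at most
    [min B (M |xi|)] uniformly in [x]; the mean of this modulus against
    [rho eps] tends to 0 because [rho eps] concentrates at the origin
    ([mean_modulus_cvg0]).

    Convergence in L^p.  The error is thus uniformly small ([error_sup]).  Its
    integral is equally small ([error_L1]): by Tonelli one may integrate in [x]
    first, and for fixed [xi] the remainder lives on a cube that contains the
    support of [f] and on the translate of that cube by [- xi], whose total volume
    does not depend on [xi].  A bound by [c] on the supremum and by a multiple of
    [c] on the integral bounds all L^p norms by a multiple of [c], since
    [|g|^p <= c^(p-1) |g|] ([Lnorm_le]).

    Convergence of test functions.  [T_i] commutes with partial derivatives
    ([nonlocal_partial_derive]) and partial derivatives commute with one another
    ([partialC]), so each derivative of the error is the error of a derivative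
    of [f] and is uniformly small as well.  If the [rho eps] vanish outside a
    common compact set, all the functions involved vanish outside a common cube;
    only finitely many derivatives enter a neighbourhood of 0 in the space of
    functions supported there. *)

(** * Measurability of continuous functions *)

Section continuous_measurable.
Context {R : realType} {n : nat}.
Implicit Types (U : set 'rV[R]_n) (f : 'rV[R]_n -> R).

(** Euclidean space is second countable: an open set is the union of the
    rational cubes that it contains, and cubes are measurable for the sigma-algebra
    generated by the coordinates. *)
Lemma open_measurable_rV U : open U -> measurable U.
Proof.
move=> oU.
pose cube (q : 'rV[rat]_n * rat) : set 'rV[R]_n :=
  [set x | forall i, `|ratr (q.1 0 i) - x 0 i| < ratr q.2].
have mcube q : measurable (cube q).
  have -> : cube q = \bigcap_(i in [set: 'I_n])
     ((fun x : 'rV[R]_n => x 0 i) @^-1` [set t | `|ratr (q.1 0 i) - t| < ratr q.2]).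
    by apply/seteqP; split => [x h i _|x h i]; apply: h.
  apply: fin_bigcap_measurable => // i _.
  rewrite -[X in measurable X]setTI; apply: measurable_coord => //.
  apply: open_measurable; apply: open_comp (@open_lt R (ratr q.2)) => t _.
  apply: (@continuous_comp _ _ _ (fun t : R => ratr (q.1 0 i) - t) Num.norm).
    by apply: cvgB; [exact: cvg_cst|exact: cvg_id].
  exact: norm_continuous.
have -> : U = \bigcup_q (cube q `&` [set _ | cube q `<=` U]).
  apply/seteqP; split => [x Ux|x [q _ [qx /= qU]]]; last exact: qU.
  have /nbhs_ballP[e /= e0 eU] := open_nbhs_nbhs (conj oU Ux).
  have e20 : 0 < e / 2 by rewrite divr_gt0.
  have [r /= ] := rat_in_itvoo e20; rewrite in_itv /= => /andP[r0 re].
  have /choice[q hq] : forall i, exists q : rat, `|ratr q - x 0 i| < (ratr r : R).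
    move=> i; have /rat_in_itvoo[q /=] : x 0 i - ratr r < x 0 i + ratr r.
      by rewrite ltrBlDr -addrA ltrDl addr_gt0.
    by rewrite in_itv/= => qq; exists q; rewrite ltr_distl.
  exists (\row_i q i, r) => //; split.
    by move=> i; rewrite /= mxE.
  move=> y /= hy; apply: eU; split=> // i j; rewrite ord1.
  have := hy j; rewrite /= mxE => yj.
  rewrite /ball/=; have -> : x 0 j - y 0 j = (x 0 j - ratr (q j)) + (ratr (q j) - y 0 j).
    by rewrite addrA subrK.
  rewrite (le_lt_trans (ler_normD _ _))// (splitr e) ltrD//.
    by rewrite distrC (lt_trans (hq j)).
  by rewrite (lt_trans yj).
apply: countable_bigcupT_measurable => // q.
have [qU|qU] := pselect (cube q `<=` U).
  rewrite (_ : _ `&` _ = cube q)//.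
  by apply/seteqP; split => [x []|x].
by rewrite (_ : _ `&` _ = set0)//; apply/seteqP; split => [x []|x].
Qed.

Lemma continuous_measurable_rV f : continuous f -> measurable_fun setT f.
Proof.
move=> /continuousP cf; apply: (measurability _ (RGenOpens.measurableE R)) => //.
move=> _ [_ [a [b ->] <-]]; rewrite setTI; apply: open_measurable_rV.
by apply: cf; exact: interval_open.
Qed.

End continuous_measurable.

(** * Boxes and the symmetries of Lebesgue measure *)

Section box.
Context {R : realType}.
Implicit Types n : nat.

Definition box n (Y : 'I_n -> set R) : set 'rV[R]_n :=
  [set x | forall i, Y i (x 0 i)].

Lemma measurable_box n (Y : 'I_n -> set R) :
  (forall i, measurable (Y i)) -> measurable (box Y).
Proof.
move=> mY.
have -> : box Y = \bigcap_(i in [set: 'I_n]) ((fun x : 'rV[R]_n => x 0 i) @^-1` Y i).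
  by apply/seteqP; split => [x h i _|x h i]; apply: h.
apply: fin_bigcap_measurable => // i _.
by rewrite -[X in measurable X]setTI; apply: measurable_coord.
Qed.

Lemma rV_cons_lshift n (p : measurableTypeR R * 'rV[R]_n) i j :
  rV_cons p i (lshift n j) = p.1.
Proof. by rewrite /rV_cons row_mxEl mxE !ord1 eqxx mulr1n. Qed.

Lemma rV_cons_rshift n (p : measurableTypeR R * 'rV[R]_n) i j :
  rV_cons p i (rshift 1 j) = p.2 0 j.
Proof. by rewrite /rV_cons row_mxEr !ord1. Qed.

(** Along the iterated product that defines the measure, a box is a rectangle
    whose second factor is again a box. *)
Lemma lebesgue_rV_box n (Y : 'I_n -> set R) : (forall i, measurable (Y i)) ->
  lebesgue_rV R n (box Y) = (\prod_(i < n) lebesgue_measure (Y i))%E.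
Proof.
elim: n Y => [|n IHn] Y mY.
  rewrite big_ord0 /= diracE mem_set//.
  by move=> [].
have Y0 : @lshift 1 n ord0 = ord0 by apply/val_inj.
have YS i : @rshift 1 n i = lift ord0 i by apply/val_inj.
rewrite big_ord_recl -IHn//.
rewrite -product_measure1E//; last exact: measurable_box.
rewrite /= /lebesgue_step /pushforward; congr (_ _).
apply/seteqP; split => [p /= h|p /= [h0 hS] i].
  split => [|i] /=.
    by have := h (@lshift 1 n ord0); rewrite Y0 -[in rV_cons p 0 _]Y0 rV_cons_lshift.
  by have := h (@rshift 1 n i); rewrite YS -[in rV_cons p 0 _]YS rV_cons_rshift.
case: (@split_ordP 1 n i) => k ->.
  by rewrite rV_cons_lshift ord1 Y0.
by rewrite rV_cons_rshift YS; exact: hS.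
exact: mY.
Qed.

(** A coordinate cylinder is a box with all other sides full. *)
Lemma measurable_rV_box n :
  @measurable _ 'rV[R]_n =
  <<s [set B | exists2 Y, (forall i, measurable (Y i)) & B = box Y] >>.
Proof.
apply/seteqP; split => A.
  apply: smallest_sub; first exact: smallest_sigma_algebra.
  move=> _ [i [j [Y [mY ->]]]]; apply: sub_sigma_algebra.
  exists (fun k => if k == j then Y else setT).
    by move=> k; case: ifP.
  apply/seteqP; rewrite (ord1 i); split => [x /= Yx k|x /(_ j)].
    by case: ifP => // /eqP ->.
  by rewrite eqxx.
apply: smallest_sub; first exact: sigma_algebra_measurable.
by move=> _ [Y mY ->]; exact: measurable_box.
Qed.

Definition cube n (c : 'rV[R]_n) (r : R) := box (fun i => ball (c 0 i) r).

Lemma measurable_cube n (c : 'rV[R]_n) r : measurable (cube c r).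
Proof. by apply: measurable_box => i; exact: measurable_ball. Qed.

Lemma lebesgue_rV_cube n (c : 'rV[R]_n) r : 0 <= r ->
  lebesgue_rV R n (cube c r) = ((r *+ 2) ^+ n)%:E.
Proof.
move=> r0; rewrite lebesgue_rV_box; last by move=> i; exact: measurable_ball.
rewrite (eq_bigr (fun=> (r *+ 2)%:E)); last first.
  by move=> i _; rewrite lebesgue_measure_ball.
by rewrite prodEFin prodr_const card_ord.
Qed.

(** Boxes form a pi-system that generates the sigma-algebra and contains an
    exhausting sequence of cubes of finite measure, so two measures that agree on
    boxes are equal. *)
Lemma lebesgue_rV_invariant n (phi : 'rV[R]_n -> 'rV[R]_n) :
  measurable_fun setT phi ->
  (forall Y, (forall i, measurable (Y i)) ->
    lebesgue_rV R n (phi @^-1` box Y) = lebesgue_rV R n (box Y)) ->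
  forall A, measurable A -> pushforward (lebesgue_rV R n) phi A = lebesgue_rV R n A.
Proof.
move=> mphi phiE A mA; apply/esym.
pose g (k : nat) := cube (0 : 'rV[R]_n) k%:R.
apply: (measure_unique _ g (measurable_rV_box n) _ _ _ (lebesgue_rV R n)
 (measure_function_pushforward__canonical__measure_function_Measure (lebesgue_rV R n) mphi)) => //.
- move=> _ _ [Y1 mY1 ->] [Y2 mY2 ->]; exists (fun i => Y1 i `&` Y2 i).
    by move=> i; exact: measurableI.
  by apply/seteqP; split => [x [h1 h2] i|x h]; [split|split => i; have [] := h i].
- move=> k; exists (fun i => ball ((0 : 'rV[R]_n) 0 i) k%:R) => // i.
  exact: measurable_ball.
- rewrite -subTset => x _.
  exists (\max_i (Num.truncn `|x ord0 i|).+1) => // i; rewrite mxE.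
  rewrite /ball/= sub0r normrN (lt_le_trans (truncnS_gt _))// ler_nat.
  exact: (leq_bigmax i).
- by move=> _ [Y mY ->]; rewrite /= /pushforward phiE.
- by move=> k; rewrite /= /g lebesgue_rV_cube// ltry.
Qed.

End box.

(** * Isometries and second moments of a radial kernel *)

Section isometries.
Context {R : realType} {n : nat}.
Local Notation mu := (lebesgue_rV R n).
Implicit Types (f rho : 'rV[R]_n -> R) (phi : 'rV[R]_n -> 'rV[R]_n).

Definition preserves_boxes phi :=
  forall Y : 'I_n -> set R, (forall i, measurable (Y i)) ->
    mu (phi @^-1` box Y) = mu (box Y).

Lemma Rintegral_comp_box phi f : measurable_fun setT phi -> preserves_boxes phi ->
  measurable_fun setT f -> mu.-integrable setT (EFin \o (f \o phi)) ->
  \int[mu]_x f (phi x) = \int[mu]_x f x.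
Proof.
move=> mphi phiE mf ifphi; congr fine.
pose m := measure_function_pushforward__canonical__measure_function_Measure mu mphi.
transitivity (\int[m]_x (f x)%:E)%E; last first.
  by apply: eq_measure_integral => A mA _; exact: lebesgue_rV_invariant.
by rewrite integral_pushforward//; exact/measurable_EFinP.
Qed.

Definition flip (j : 'I_n) (x : 'rV[R]_n) : 'rV[R]_n :=
  \row_i (if i == j then - x 0 i else x 0 i).

Lemma measurable_flip j : measurable_fun setT (flip j).
Proof.
apply: measurable_fun_mxP => i k.
under eq_fun do rewrite mxE.
have mk : measurable_fun setT (fun x : 'rV[R]_n => x 0 k) by exact: measurable_coord.
by case: (k == j) => //; exact: measurableT_comp.
Qed.

Lemma flip_preserves_boxes j : preserves_boxes (flip j).
Proof.
move=> Y mY.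
pose Y' i := if i == j then -%R @^-1` Y i else Y i.
have mY' i : measurable (Y' i).
  rewrite /Y'; case: ifP => // _; rewrite -[X in measurable X]setTI.
  exact: (oppr_measurable measurableT).
rewrite (_ : _ @^-1` _ = box Y'); last first.
  apply/seteqP; split => x xY i; have := xY i; rewrite /Y' /flip mxE;
  by case: ifP.
rewrite !lebesgue_rV_box//; apply: eq_bigr => i _; rewrite /Y'; case: ifP => // _.
exact: lebesgue_measureN.
Qed.

Lemma col_perm_preserves_boxes s : preserves_boxes (col_perm s).
Proof.
move=> Y mY.
rewrite (_ : _ @^-1` _ = box (Y \o (s^-1)%g)); last first.
  apply/seteqP; split => x xY i /=.
    by have := xY (s^-1 i)%g; rewrite mxE permKV.
  by have := xY (s i); rewrite mxE /= permK.
rewrite !lebesgue_rV_box//; last by move=> i; exact: mY.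
by rewrite [RHS](reindex_perm s^-1).
Qed.

Lemma measurable_col_perm s : measurable_fun setT (col_perm s : 'rV[R]_n -> _).
Proof.
apply: measurable_fun_mxP => i k.
by under eq_fun do rewrite mxE; exact: measurable_coord.
Qed.

Lemma enorm_flip j x : enorm (flip j x) = enorm x.
Proof.
rewrite /enorm /flip; congr Num.sqrt; apply: eq_bigr => i _; rewrite mxE.
by case: ifP => // _; rewrite sqrrN.
Qed.

Lemma enorm_col_perm s (x : 'rV[R]_n) : enorm (col_perm s x) = enorm x.
Proof.
rewrite /enorm; congr Num.sqrt; rewrite [RHS](reindex_perm s).
by apply: eq_bigr => i _; rewrite mxE.
Qed.

Lemma enorm_ge0 (x : 'rV[R]_n) : 0 <= enorm x. Proof. exact: sqrtr_ge0. Qed.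

Lemma enorm_sqr (x : 'rV[R]_n) : enorm x ^+ 2 = \sum_(i < n) x 0 i ^+ 2.
Proof. by rewrite sqr_sqrtr// sumr_ge0// => i _; exact: sqr_ge0. Qed.

Lemma coord_le_enorm (x : 'rV[R]_n) i : `|x 0 i| <= enorm x.
Proof.
rewrite -(@ler_pXn2r _ 2) ?nnegrE ?enorm_ge0// enorm_sqr (bigD1 i)//= real_normK ?num_real//.
by rewrite lerDl sumr_ge0// => j _; exact: sqr_ge0.
Qed.

Lemma enorm_eq0 (x : 'rV[R]_n) : (enorm x == 0) = (x == 0).
Proof.
apply/idP/idP => [/eqP x0|/eqP ->].
  apply/eqP/rowP => i; rewrite mxE; apply/eqP; rewrite -normr_le0.
  by rewrite -x0 coord_le_enorm.
by rewrite /enorm big1 ?sqrtr0// => i _; rewrite mxE expr0n.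
Qed.

Lemma measurable_enorm : measurable_fun setT (@enorm R n).
Proof.
apply: (measurableT_comp (f := @Num.sqrt R)).
  exact: continuous_measurable_fun (@sqrt_continuous R).
apply: measurable_sum => i; apply: measurable_funX; exact: measurable_coord.
Qed.

(** The coordinates of [x / |x|]; they vanish at the origin since [0^-1 = 0]. *)
Definition dir (i : 'I_n) (x : 'rV[R]_n) : R := (enorm x)^-1 * x 0 i.

Lemma dir_le1 i x : `|dir i x| <= 1.
Proof.
rewrite /dir normrM normfV (ger0_norm (enorm_ge0 x)).
have [x0|x0] := eqVneq (enorm x) 0; first by rewrite x0 invr0 mul0r.
by rewrite ler_pdivrMl ?mulr1 ?coord_le_enorm// lt0r x0 enorm_ge0.
Qed.

Lemma measurable_enormV : measurable_fun setT (fun x : 'rV[R]_n => (enorm x)^-1).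
Proof.
under eq_fun do rewrite -powR_inv1 ?enorm_ge0//.
apply: (measurableT_comp (f := @powR R ^~ (-1))); first exact: measurable_powR.
exact: measurable_enorm.
Qed.

Lemma measurable_dir i : measurable_fun setT (dir i).
Proof.
by apply: measurable_funM; [exact: measurable_enormV|exact: measurable_coord].
Qed.

Lemma integrable_le_cM rho f C : mu.-integrable setT (EFin \o rho) ->
  measurable_fun setT f -> (forall x, `|f x| <= C * rho x) ->
  mu.-integrable setT (EFin \o f).
Proof.
move=> irho mf fC; apply: (le_integrable _ _ _ (integrableZl measurableT C irho)) => //.
  exact/measurable_EFinP.
by move=> x _ /=; rewrite lee_fin (le_trans (fC x))// ler_norm.
Qed.

Lemma singleton0_box : [set 0 : 'rV[R]_n] = box (fun=> [set 0]).
Proof.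
apply/seteqP; split => [x -> i|x x0]; first by rewrite mxE.
by apply/rowP => i; rewrite (x0 i) mxE.
Qed.

Lemma measurable_singleton0 : measurable [set 0 : 'rV[R]_n].
Proof. by rewrite singleton0_box; apply: measurable_box => i; exact: measurable_set1. Qed.

Lemma lebesgue_rV_singleton0 : (0 < n)%N -> mu [set 0] = 0%E.
Proof.
move=> n0; rewrite singleton0_box lebesgue_rV_box//.
rewrite (eq_bigr (fun=> 0%E)) => [|i _]; last exact: lebesgue_measure_set1.
by case: n n0 => // m _; rewrite big_ord_recl mul0e.
Qed.

Lemma Rintegral_sum_rV (D : set 'rV[R]_n) (I : Type) (s : seq I)
    (F : I -> 'rV[R]_n -> R) : measurable D ->
  (forall i, mu.-integrable D (EFin \o F i)) ->
  \int[mu]_(x in D) (\sum_(i <- s) F i x) = \sum_(i <- s) \int[mu]_(x in D) F i x.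
Proof.
move=> mD iF; elim: s => [|i s IHs].
  by rewrite big_nil; under eq_Rintegral do rewrite big_nil; rewrite Rintegral_cst// mul0r.
rewrite big_cons -IHs -RintegralD//; first by under eq_Rintegral do rewrite big_cons.
apply: (eq_integrable mD (fun x => \sum_(i <- s) (F i x)%:E)%E).
  by move=> x _ /=; rewrite sumEFin.
by apply: (integrable_sum mD) => j _; exact: iF.
Qed.

Section second_moments.
Variable rho : 'rV[R]_n -> R.
Hypotheses (rho_int : mu.-integrable setT (EFin \o rho))
  (rho_ge0 : forall x, 0 <= rho x) (rho_radial : radial rho).

Let m_rho : measurable_fun setT rho.
Proof. by apply/measurable_EFinP; exact: measurable_int rho_int. Qed.

Let M i j := \int[mu]_x (rho x * (dir i x * dir j x)).

Let mM i j : measurable_fun setT (fun x => rho x * (dir i x * dir j x)).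
Proof.
by apply: measurable_funM => //; apply: measurable_funM; exact: measurable_dir.
Qed.

Let iM i j : mu.-integrable setT (EFin \o (fun x => rho x * (dir i x * dir j x))).
Proof.
apply: (@integrable_le_cM rho _ 1) => // x.
rewrite normrM ger0_norm// mulrC ler_wpM2r// normrM.
by rewrite mulr_ile1// dir_le1.
Qed.

Lemma offdiag_moment i j : i != j -> M i j = 0.
Proof.
move=> ij; suff : M i j = - M i j.
  by move/eqP; rewrite -addr_eq0 -mulr2n mulrn_eq0/= => /eqP.
have fE x : rho (flip i x) * (dir i (flip i x) * dir j (flip i x)) =
    -1 * (rho x * (dir i x * dir j x)).
  rewrite (rho_radial (enorm_flip i x)) /dir enorm_flip !mxE eqxx.
  by rewrite eq_sym (negbTE ij) !(mulrN, mulNr) mul1r.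
rewrite {1}/M -(Rintegral_comp_box (measurable_flip i) (@flip_preserves_boxes i)
  (mM i j)); last first.
  rewrite (_ : _ \o _ = EFin \o (fun x => -1 * (rho x * (dir i x * dir j x)))).
    exact: (integrableZl measurableT (-1) (iM i j)).
  by apply/funext => x /=; rewrite fE.
under eq_Rintegral do rewrite fE.
by rewrite RintegralZl// mulN1r.
Qed.

Lemma diag_moment_swap i j : M i i = M j j.
Proof.
have fE x : rho (col_perm (tperm i j) x) *
    (dir i (col_perm (tperm i j) x) * dir i (col_perm (tperm i j) x)) =
    rho x * (dir j x * dir j x).
  rewrite (rho_radial (enorm_col_perm _ x)) /dir enorm_col_perm !mxE.
  by rewrite tpermL.
rewrite {1}/M -(Rintegral_comp_box (@measurable_col_perm (tperm i j))
   (@col_perm_preserves_boxes (tperm i j)) (mM i i)); last first.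
  rewrite (_ : _ \o _ = EFin \o (fun x => rho x * (dir j x * dir j x)))//.
  by apply/funext => x /=; rewrite fE.
by under eq_Rintegral do rewrite fE.
Qed.

(** The off-diagonal moments change sign under a reflection and the diagonal ones
    are exchanged by transpositions, while the latter add up to the mass of [rho]
    because [sum_i dir i x ^+ 2 = 1] off the origin, a null set when [0 < n]. *)
Lemma second_moment i j : (0 < n)%N ->
  n%:R * M i j = (i == j)%:R * \int[mu]_x rho x.
Proof.
move=> n0; have [<-{j}|ij] := eqVneq i j; last first.
  by rewrite offdiag_moment// mulr0 mul0r.
rewrite mul1r.
have -> : n%:R * M i i = \sum_(j < n) M j j.
  rewrite (eq_bigr (fun=> M i i)); last by move=> j _; exact: diag_moment_swap.
  by rewrite sumr_const card_ord mulr_natl.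
rewrite -Rintegral_sum_rV//.
congr fine; apply: ae_eq_integral => //.
- apply/measurable_EFinP; apply: measurable_sum => j; exact: mM.
- exact/measurable_EFinP.
exists [set 0]; split; [|exact: lebesgue_rV_singleton0|].
  exact: measurable_singleton0.
move=> x /= xN0; apply/eqP; rewrite -enorm_eq0; apply/negPn/negP => x0.
apply: xN0 => _; rewrite -mulr_sumr.
rewrite (eq_bigr (fun j => (enorm x ^+ 2)^-1 * x 0 j ^+ 2)); last first.
  by move=> j _; rewrite /dir mulrACA -!expr2 exprVn.
by rewrite -mulr_sumr -enorm_sqr mulVf ?mulr1// expf_neq0.
Qed.

End second_moments.
End isometries.

(** * Mean value estimates from partial derivatives *)

Section calculus.
Context {R : realType} {n : nat}.
Implicit Types (f : 'rV[R]_n -> R) (x y v xi : 'rV[R]_n).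

Local Notation e_ i := (delta_mx 0 i : 'rV[R]_n).
Local Notation "'d_ i f" := ('D_(e_ i) f) (at level 10, i at level 8, f at level 8).

Lemma is_derive_line f x v t : derivable f (t *: v + x) v ->
  is_derive t (1 : R) (fun s : R => f (s *: v + x)) ('D_v f (t *: v + x)).
Proof.
move=> df.
have E : (fun h : R =>
         h^-1 *: (((fun s : R => f (s *: v + x)) \o shift t) (h *: 1) - f (t *: v + x)))
       = (fun h : R => h^-1 *: ((f \o shift (t *: v + x)) (h *: v) - f (t *: v + x))).
  apply/funext => h /=; congr (_ *: (f _ - _)).
  by rewrite addrA -scalerDl [h *: 1]mulr1.
by apply: DeriveDef; rewrite /derivable /derive E.
Qed.

Lemma MVT_line f x v h : (forall y, derivable f y v) ->
  exists2 c, `|c| <= `|h| & f (h *: v + x) - f x = h * 'D_v f (c *: v + x).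
Proof.
move=> df; pose g (s : R) := f (s *: v + x).
have dg (t : R) : is_derive t (1 : R) g ('D_v f (t *: v + x)) by exact: is_derive_line.
have cg : continuous g.
  by move=> t; apply/differentiable_continuous/derivable1_diffP; case: (dg t).
have -> : f x = g 0 by rewrite /g scale0r add0r.
rewrite -/(g h); have [h0|h0] := leP 0 h.
  have [c] := MVT_segment h0 (fun t _ => dg t) (continuous_subspaceT cg).
  rewrite in_itv/= => /andP[c0 ch] E.
  by exists c; [rewrite !ger0_norm|rewrite E subr0 mulrC].
have [c] := MVT_segment (ltW h0) (fun t _ => dg t) (continuous_subspaceT cg).
rewrite in_itv/= => /andP[hc c0] E.
exists c; first by rewrite !ler0_norm ?lerN2// ltW.
by rewrite -opprB E sub0r mulrN opprK mulrC.
Qed.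

(** Moving from [x] to [x + xi] one coordinate at a time and applying the mean
    value theorem to each step needs partial derivatives only.  With [a = 0] this
    is a Lipschitz estimate, with [a i] the partial derivatives at [x] it bounds
    the first-order Taylor remainder. *)
Lemma increment_bound f x xi (a B : 'I_n -> R) :
  (forall i y, derivable f y (e_ i)) ->
  (forall i y, (forall k, `|y 0 k - x 0 k| <= `|xi 0 k|) ->
    `|'d_ i f y - a i| <= B i) ->
  `|f (x + xi) - f x - \sum_(i < n) xi 0 i * a i| <= \sum_(i < n) `|xi 0 i| * B i.
Proof.
move=> df dfB.
(* The increment with only its first [m] coordinates switched on. *)
pose xi_ m : 'rV[R]_n := \row_k (if (k < m)%N then xi 0 k else 0).
have xi_n : xi_ n = xi by apply/rowP => k; rewrite mxE ltn_ord.
have xi_0 : xi_ 0%N = 0 by apply/rowP => k; rewrite !mxE.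
suff H m : (m <= n)%N ->
  `|f (x + xi_ m) - f x - \sum_(i < n | (i < m)%N) xi 0 i * a i|
    <= \sum_(i < n | (i < m)%N) `|xi 0 i| * B i.
  have := H n (leqnn n); rewrite xi_n.
  under eq_bigl do rewrite ltn_ord.
  by under [leRHS]eq_bigl do rewrite ltn_ord.
elim: m => [_|m IHm mn].
  by rewrite xi_0 addr0 subrr !big1// ?subrr ?normr0// => i; rewrite ltn0.
pose j := Ordinal mn.
have sumS (F : 'I_n -> R) : \sum_(i < n | (i < m.+1)%N) F i
    = F j + \sum_(i < n | (i < m)%N) F i.
  rewrite (bigD1 j)//=; congr (_ + _); apply: eq_bigl => i.
  by rewrite -val_eqE/= ltnS [RHS]ltn_neqAle andbC.
have xiS : x + xi_ m.+1 = xi 0 j *: e_ j + (x + xi_ m).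
  apply/rowP => k; rewrite !mxE eqxx/= addrCA; congr (_ + _).
  rewrite ltnS leq_eqVlt -(inj_eq val_inj)/= eq_sym.
  case: (eqVneq m k) => [mk|mk] /=; last by rewrite mulr0 add0r.
  rewrite -mk ltnn addr0 mulr1; congr (xi 0 _); exact/val_inj.
rewrite !sumS xiS.
have [c cxi E] := MVT_line (x + xi_ m) (xi 0 j) (fun y => df j y).
set z := c *: _ + _ in E.
have -> : f (xi 0 j *: e_ j + (x + xi_ m)) - f x -
    (xi 0 j * a j + \sum_(i < n | (i < m)%N) xi 0 i * a i) =
  xi 0 j * ('d_ j f z - a j) +
   (f (x + xi_ m) - f x - \sum_(i < n | (i < m)%N) xi 0 i * a i).
  by move: E => /eqP; rewrite subr_eq => /eqP ->; ring.
rewrite (le_trans (ler_normD _ _))// lerD ?IHm ?(ltnW mn)// normrM ler_wpM2l//.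
apply: dfB => k; rewrite /z !mxE eqxx/=.
rewrite (addrC (x 0 k)) addrA addrK.
have [->|kj] := eqVneq k j; first by rewrite ltnn mulr1 addr0.
by rewrite mulr0 add0r; case: ifP => // _; rewrite normr0.
Qed.

End calculus.

(** * Smooth functions with bounded derivatives *)

Section bounded_smooth.
Context {R : realType} {n : nat}.
Implicit Types (f : 'rV[R]_n -> R) (x y v xi : 'rV[R]_n) (s : seq 'I_n).

Local Notation e_ i := (delta_mx 0 i : 'rV[R]_n).
Local Notation "'d_ i f" := ('D_(e_ i) f) (at level 10, i at level 8, f at level 8).

Lemma continuous_enorm : continuous (@enorm R n).
Proof.
move=> x; apply: (@continuous_comp _ _ _ (fun x : 'rV[R]_n => \sum_(i < n) x 0 i ^+ 2) Num.sqrt).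
  apply: continuous_big => [|i _]; first exact: add_continuous.
  move=> y; apply: (@continuous_comp _ _ _ (fun x : 'rV[R]_n => x 0 i) (fun t => t ^+ 2)).
    exact: coord_continuous.
  exact: exprn_continuous.
exact: sqrt_continuous.
Qed.

Lemma lipschitz_enorm_continuous f L :
  (forall x xi, `|f (x + xi) - f x| <= L * enorm xi) -> continuous f.
Proof.
move=> fL; suff H x : f @ x --> f x by [].
have F0 : Filter (nbhs x) by exact: nbhs_filter.
apply/cvgrPdist_le => e e0.
have : enorm (y - x) @[y --> x] --> (0 : R).
  have -> : 0 = enorm (x - x) by rewrite subrr; apply/esym/eqP; rewrite enorm_eq0.
  have yx : y - x @[y --> x] --> x - x by apply: cvgB; [exact: cvg_id|exact: cvg_cst].
  exact: (continuous_cvg _ (@continuous_enorm (x - x)) yx).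
have d0 : 0 < e / (`|L| + 1) by rewrite divr_gt0// ltr_wpDl.
move/cvgrPdist_le/(_ _ d0); apply: filterS => y.
rewrite sub0r normrN ger0_norm ?enorm_ge0// => yx.
have := fL x (y - x); rewrite (addrC x) subrK distrC => /le_trans; apply.
rewrite (@le_trans _ _ (`|L| * (e / (`|L| + 1))))//.
  by rewrite (le_trans (ler_wpM2r (enorm_ge0 _) (ler_norm L)))// ler_wpM2l.
by rewrite mulrCA ler_piMr ?(ltW e0)// ler_pdivrMr ?ltr_wpDl// mul1r lerDl.
Qed.

Definition pderivs s f := foldr (fun i g => 'd_ i g) f s.

(** The class in which scalar functions are handled: unlike test functions it is
    preserved by the nonlocal operator whatever the support of the kernel. *)
Definition bsmooth f := forall s,
  (exists B, forall x, `|pderivs s f x| <= B) /\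
  forall i x, derivable (pderivs s f) x (e_ i).

Lemma bsmooth_pderivs s f : bsmooth f -> bsmooth (pderivs s f).
Proof. by move=> fs t; rewrite /pderivs -foldr_cat; exact: fs. Qed.

Lemma bsmooth_partial i f : bsmooth f -> bsmooth ('d_ i f).
Proof. exact: (@bsmooth_pderivs [:: i]). Qed.

Lemma bsmooth_derivable f i x : bsmooth f -> derivable f x (e_ i).
Proof. by move=> /(_ [::])[]. Qed.

Lemma bsmooth_bounded f : bsmooth f -> exists2 B, 0 <= B & forall x, `|f x| <= B.
Proof. by move=> /(_ [::])[[B fB] _]; exists B => //; exact: le_trans (fB 0). Qed.

Lemma bsmooth_lipschitz f : bsmooth f ->
  exists2 L, 0 <= L & forall x xi, `|f (x + xi) - f x| <= L * enorm xi.
Proof.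
move=> fs; have /choice[B fB] : forall i, exists B, 0 <= B /\ forall x, `|'d_ i f x| <= B.
  by move=> i; have [B] := bsmooth_bounded (bsmooth_partial i fs); exists B.
exists (\sum_i B i) => [|x xi]; first by apply: sumr_ge0 => i _; case: (fB i).
apply: (@le_trans _ _ (\sum_i `|xi 0 i| * B i)).
  have := @increment_bound _ _ f x xi (fun=> 0) B (fun i y => bsmooth_derivable fs).
  rewrite big1 ?subr0 => [|i _]; last by rewrite mulr0.
  by apply => i y _; rewrite subr0; case: (fB i).
rewrite mulr_suml ler_sum// => i _; rewrite mulrC ler_wpM2l ?coord_le_enorm//.
by case: (fB i).
Qed.

Lemma bsmooth_continuous f : bsmooth f -> continuous f.
Proof. by move=> /bsmooth_lipschitz[L _]; exact: lipschitz_enorm_continuous. Qed.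

Lemma bsmooth_taylor f : bsmooth f ->
  exists2 M, 0 <= M & forall x xi,
    `|f (x + xi) - f x - \sum_(i < n) xi 0 i * 'd_ i f x| <= M * enorm xi ^+ 2.
Proof.
move=> fs; have /choice[B fB] : forall p : 'I_n * 'I_n, exists B, 0 <= B /\
    forall x, `|'d_ p.2 ('d_ p.1 f) x| <= B.
  move=> [i j]; have [B] := bsmooth_bounded (bsmooth_partial j (bsmooth_partial i fs)).
  by exists B.
exists (\sum_i \sum_j B (i, j)) => [|x xi].
  by apply: sumr_ge0 => i _; apply: sumr_ge0 => j _; case: (fB (i, j)).
pose C i := \sum_j B (i, j) * enorm xi.
apply: (@le_trans _ _ (\sum_i `|xi 0 i| * C i)); last first.
  rewrite mulr_suml ler_sum// => i _; rewrite /C mulr_suml mulr_sumr ler_sum// => j _.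
  have [B0 _] := fB (i, j).
  by rewrite expr2 mulrCA ler_wpM2l// ler_wpM2r ?enorm_ge0// coord_le_enorm.
apply: (increment_bound (fun i y => bsmooth_derivable fs)) => i y yx.
apply: (@le_trans _ _ (\sum_j `|(y - x) 0 j| * B (i, j))).
  have := @increment_bound _ _ ('d_ i f) x (y - x) (fun=> 0) (fun j => B (i, j))
    (fun j y => bsmooth_derivable (bsmooth_partial i fs)).
  rewrite big1 ?subr0 => [|j _]; last by rewrite mulr0.
  rewrite (addrC x) subrK; apply.
  by move=> j z _; rewrite subr0; have [_] := fB (i, j); apply.
rewrite ler_sum// => j _; rewrite mulrC ler_wpM2l//; first by case: (fB (i, j)).
rewrite !mxE; exact: le_trans (coord_le_enorm _ _).
Qed.

(** An error that is quadratic in [h] exhibits a derivative and permits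
    differentiation under the integral sign by estimates alone. *)
Lemma quadratic_remainder_derive f x v d C :
  (forall h : R, `|f (h *: v + x) - f x - h * d| <= C * h ^+ 2) ->
  derivable f x v /\ 'D_v f x = d.
Proof.
move=> fC.
suff H : (fun h : R => h^-1 *: ((f \o shift x) (h *: v) - f x)) @ 0^' --> d.
  by split; [apply/cvg_ex; exists d|exact: cvg_lim].
apply/cvgrPdist_le => e e0.
have d0 : 0 < e / (`|C| + 1) by rewrite divr_gt0// ltr_wpDl.
near=> h.
have h0 : h != 0 by near: h; exact: nbhs_dnbhs_neq.
have hd : `|h| <= e / (`|C| + 1).
  by near: h; exact: dnbhs0_le.
rewrite distrC /=.
have -> : h^-1 *: (f (h *: v + x) - f x) - d = h^-1 * (f (h *: v + x) - f x - h * d).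
  by rewrite mulrBr mulrA mulVf// mul1r.
rewrite normrM normfV ler_pdivrMl ?normr_gt0// (le_trans (fC h))//.
rewrite -(real_normK (num_real h)) expr2 mulrCA ler_wpM2l//.
rewrite (@le_trans _ _ (`|C| * (e / (`|C| + 1))))//.
  by rewrite (le_trans (ler_wpM2r _ (ler_norm C)))// ler_wpM2l.
by rewrite mulrCA ler_piMr ?(ltW e0)// ler_pdivrMr ?ltr_wpDl// mul1r lerDl.
Unshelve. all: by end_near. Qed.

Lemma derivable_translate f x xi v : derivable f (x + xi) v ->
  derivable (fun y => f (y + xi)) x v /\
  'D_v (fun y => f (y + xi)) x = 'D_v f (x + xi).
Proof.
have E : (fun h : R => h^-1 *: (((fun y => f (y + xi)) \o shift x) (h *: v) - f (x + xi)))
  = (fun h : R => h^-1 *: ((f \o shift (x + xi)) (h *: v) - f (x + xi))).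
  by apply/funext => h /=; rewrite addrA.
by rewrite /derivable /derive E.
Qed.

End bounded_smooth.

(** * The scalar nonlocal partial derivative *)

Section scalar_operator.
Context {R : realType} {n : nat}.
Local Notation mu := (lebesgue_rV R n).
Implicit Types (f F G : 'rV[R]_n -> R) (x y v xi : 'rV[R]_n) (s : seq 'I_n).

Local Notation e_ i := (delta_mx 0 i : 'rV[R]_n).
Local Notation "'d_ i f" := ('D_(e_ i) f) (at level 10, i at level 8, f at level 8).

Definition increment f x xi := f (x + xi) - f x.

Lemma increment_derive f i xi y : bsmooth f ->
  derivable (fun y => increment f y xi) y (e_ i) /\
  'd_ i (fun y => increment f y xi) y = increment ('d_ i f) y xi.
Proof.
move=> fs.
have [d1 E1] := derivable_translate (@bsmooth_derivable _ _ f i (y + xi) fs).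
have d2 := @bsmooth_derivable _ _ f i y fs.
rewrite (_ : (fun y => _) = (fun y => f (y + xi)) - f); last by apply/funext.
by split; [exact: derivableB|rewrite deriveB// E1].
Qed.

(** Two applications of the mean value theorem in direction [i] produce a second
    derivative of [f] evaluated at two points at distance [xi], hence the factor
    [|xi|] that compensates the singularity of the kernel. *)
Lemma increment_second_order f i : bsmooth f ->
  exists2 C, 0 <= C & forall x xi (h : R),
    `|increment f (h *: e_ i + x) xi - increment f x xi - h * increment ('d_ i f) x xi|
      <= C * h ^+ 2 * enorm xi.
Proof.
move=> fs; have fs1 := bsmooth_partial i fs.
have [L L0 fL] := bsmooth_lipschitz (bsmooth_partial i fs1).
exists L => // x xi h.
have [c ch ->] := MVT_line x h (fun y => (increment_derive i xi y fs).1).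
rewrite (increment_derive i xi _ fs).2 -mulrBr.
have [c' _ ->] := MVT_line x c (fun y => (increment_derive i xi y fs1).1).
rewrite (increment_derive i xi _ fs1).2 !normrM.
rewrite -(real_normK (num_real h)).
rewrite (_ : _ * enorm xi = `|h| * (`|h| * (L * enorm xi))); last by ring.
by rewrite ler_wpM2l//; apply: ler_pM => //; exact: fL.
Qed.

Lemma enorm_scale_e (h : R) i : enorm (h *: e_ i) = `|h|.
Proof.
rewrite /enorm (bigD1 i)//= big1 => [|j ji]; last first.
  by rewrite !mxE (negbTE ji) andbF mulr0 expr0n.
by rewrite !mxE !eqxx mulr1 addr0 sqrtr_sqr.
Qed.

(** [increment_second_order] in direction [i], followed by the Taylor estimate of
    the [i]-th partial derivative in direction [j]. *)
Lemma second_difference f i j x : bsmooth f ->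
  exists2 C, 0 <= C & forall h : R,
    `|increment f (h *: e_ i + x) (h *: e_ j) - increment f x (h *: e_ j)
       - h ^+ 2 * 'd_ j ('d_ i f) x| <= C * `|h| ^+ 3.
Proof.
move=> fs; have [C C0 fC] := increment_second_order i fs.
have [M M0 fM] := bsmooth_taylor (bsmooth_partial i fs).
exists (C + M) => [|h]; first exact: addr_ge0.
have fCh := fC x (h *: e_ j) h; have fMh := fM x (h *: e_ j).
rewrite enorm_scale_e in fCh fMh.
rewrite (bigD1 j)//= big1 ?addr0 in fMh; last first.
  by move=> k kj; rewrite !mxE (negbTE kj) andbF mulr0 mul0r.
rewrite !mxE !eqxx mulr1 in fMh.
set a := increment f _ _ in fCh *; set b := increment f _ _ in fCh *.
rewrite (_ : a - b - _ = (a - b - h * increment ('d_ i f) x (h *: e_ j)) +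
  h * (increment ('d_ i f) x (h *: e_ j) - h * 'd_ j ('d_ i f) x)); last by ring.
rewrite (le_trans (ler_normD _ _))// mulrDl lerD//.
  by rewrite (le_trans fCh)// -(real_normK (num_real h)) -mulrA -exprSr.
by rewrite normrM exprS mulrCA ler_wpM2l.
Qed.

(** The second difference of [second_difference] is symmetric in [i] and [j],
    so the two mixed derivatives differ by at most a constant times [h], for
    every [h]. *)
Lemma partialC f i j : bsmooth f -> 'd_ j ('d_ i f) = 'd_ i ('d_ j f).
Proof.
move=> fs; apply/funext => x; apply/eqP; rewrite -subr_eq0 -normr_le0.
have [C C0 fC] := second_difference i j x fs.
have [D D0 fD] := second_difference j i x fs.
apply/ler_addgt0Pl => e e0; rewrite addr0.
(* A step for which the third-order error over [h ^+ 2] is at most [e]. *)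
pose h := e / (C + D + 1).
have h0 : 0 < h by rewrite divr_gt0// ltr_wpDl// addr_ge0.
have := lerD (fC h) (fD h).
set a := increment f _ _; set b := increment f _ _.
set c := increment f _ _; set d := increment f _ _.
have abcd : a - b = c - d.
  rewrite /a /b /c /d /increment (addrC (h *: e_ i) x) (addrC (h *: e_ j) x).
  by rewrite (addrAC x); ring.
move=> H; have {H} : `|h ^+ 2 * ('d_ j ('d_ i f) x - 'd_ i ('d_ j f) x)| <=
    (C + D) * `|h| ^+ 3.
  set p := 'd_ j ('d_ i f) x in H *; set q := 'd_ i ('d_ j f) x in H *.
  have -> : h ^+ 2 * (p - q) = (c - d - h ^+ 2 * q) - (a - b - h ^+ 2 * p).
    by rewrite abcd; ring.
  apply: (le_trans (ler_normB _ _)); rewrite addrC mulrDl; exact: H.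
rewrite normrM ger0_norm ?sqr_ge0// (gtr0_norm h0) (exprSr h 2) mulrCA ler_pM2l ?exprn_gt0//.
move=> /le_trans; apply.
by rewrite /h mulrCA ler_piMr ?(ltW e0)// ler_pdivrMr ?ltr_wpDl ?addr_ge0// mul1r lerDl.
Qed.

Lemma pderivs_partial s i f : bsmooth f -> pderivs s ('d_ i f) = 'd_ i (pderivs s f).
Proof.
move=> fs; elim: s => [//|j s IHs].
by rewrite [LHS]/= IHs; exact: (partialC i j (bsmooth_pderivs s fs)).
Qed.

Lemma pderivsB s f F : bsmooth f -> bsmooth F ->
  pderivs s (fun x => f x - F x) = (fun x => pderivs s f x - pderivs s F x).
Proof.
move=> fs Fs; elim: s => //= j s ->; apply/funext => x.
by rewrite (@deriveB _ _ _ (pderivs s f) (pderivs s F))//; [case: (fs s)|case: (Fs s)].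
Qed.

Lemma bsmoothB f F : bsmooth f -> bsmooth F -> bsmooth (fun x => f x - F x).
Proof.
move=> fs Fs s; rewrite pderivsB//.
have [[A fA] df] := fs s; have [[B FB] dF] := Fs s; split => [|i x].
  by exists (A + B) => x; rewrite (le_trans (ler_normB _ _))// lerD.
exact: (@derivableB _ _ _ (pderivs s f) (pderivs s F)).
Qed.

Lemma measurable_increment f x : bsmooth f -> measurable_fun setT (increment f x).
Proof.
move=> fs; apply: continuous_measurable_rV.
have [L L0 fL] := bsmooth_lipschitz fs.
apply: (@lipschitz_enorm_continuous _ _ _ L) => xi eta.
by rewrite /increment addrA opprB addrA subrK.
Qed.

Section fixed_kernel.
Variable rho : 'rV[R]_n -> R.
Hypotheses (rho_int : mu.-integrable setT (EFin \o rho))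
  (rho_ge0 : forall x, 0 <= rho x) (rho1 : \int[mu]_x rho x = 1).

Let m_rho : measurable_fun setT rho.
Proof. by apply/measurable_EFinP; exact: measurable_int rho_int. Qed.

Definition kern i F xi := rho xi * (dir i xi * ((enorm xi)^-1 * F xi)).

(** The mean that defines the operator, as a functional of the increments
    [F xi = f (x + xi) - f x] so that linearity is available. *)
Definition avg i F := n%:R * \int[mu]_xi kern i F xi.

(** The functions [F] for which [kern i F] is dominated by a multiple of [rho]. *)
Definition sublinear F := measurable_fun setT F /\
  exists2 C, 0 <= C & forall xi, `|F xi| <= C * enorm xi.

Lemma norm_enormV F xi : `|(enorm xi)^-1 * F xi| = (enorm xi)^-1 * `|F xi|.
Proof. by rewrite normrM ger0_norm// invr_ge0 enorm_ge0. Qed.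

Lemma enormV_le F C xi : 0 <= C -> `|F xi| <= C * enorm xi ->
  (enorm xi)^-1 * `|F xi| <= C.
Proof.
move=> C0 FC; have [x0|x0] := eqVneq (enorm xi) 0; first by rewrite x0 invr0 mul0r.
by rewrite ler_pdivrMl 1?mulrC// lt0r x0 enorm_ge0.
Qed.

Lemma kern_le i F xi : `|kern i F xi| <= rho xi * ((enorm xi)^-1 * `|F xi|).
Proof.
rewrite /kern normrM ger0_norm// ler_wpM2l// -norm_enormV normrM.
by rewrite ler_piMl// dir_le1.
Qed.

Lemma measurable_enormVM F : measurable_fun setT F ->
  measurable_fun setT (fun xi => (enorm xi)^-1 * F xi).
Proof. by move=> mF; apply: measurable_funM => //; exact: measurable_enormV. Qed.

Lemma measurable_kern i F : measurable_fun setT F -> measurable_fun setT (kern i F).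
Proof.
move=> mF; apply: measurable_funM => //; apply: measurable_funM.
  exact: measurable_dir.
exact: measurable_enormVM.
Qed.

Lemma integrable_kern i F : sublinear F -> mu.-integrable setT (EFin \o kern i F).
Proof.
move=> [mF [C C0 FC]]; apply: (@integrable_le_cM _ _ rho _ C) => //.
  exact: measurable_kern.
move=> xi; rewrite (le_trans (kern_le i F xi))// mulrC ler_wpM2r//.
exact: enormV_le.
Qed.

Lemma integrable_rhoM F : sublinear F ->
  mu.-integrable setT (EFin \o (fun xi => rho xi * ((enorm xi)^-1 * `|F xi|))).
Proof.
move=> [mF [C C0 FC]]; apply: (@integrable_le_cM _ _ rho _ C) => //.
  apply: measurable_funM => //; apply: measurable_enormVM.
  exact: measurableT_comp.
move=> xi; rewrite ger0_norm.
  by rewrite mulrC ler_wpM2r//; exact: enormV_le.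
by rewrite !mulr_ge0// invr_ge0 enorm_ge0.
Qed.

Lemma avg_norm i F : sublinear F ->
  `|avg i F| <= n%:R * \int[mu]_xi (rho xi * ((enorm xi)^-1 * `|F xi|)).
Proof.
move=> sF; rewrite /avg normrM normr_nat ler_wpM2l//.
rewrite (le_trans (le_normr_Rintegral _ (integrable_kern i sF)))//.
apply: le_Rintegral => //; last by move=> xi _; exact: kern_le.
  by have /integrable_norm := integrable_kern i sF.
exact: integrable_rhoM.
Qed.

Lemma avg_bound i F C : measurable_fun setT F -> 0 <= C ->
  (forall xi, `|F xi| <= C * enorm xi) -> `|avg i F| <= n%:R * C.
Proof.
move=> mF C0 FC; have sF : sublinear F by split=> //; exists C.
rewrite (le_trans (avg_norm i sF))// ler_wpM2l//.
rewrite -[leRHS]mulr1 -rho1 -RintegralZl//; apply: le_Rintegral => //.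
- exact: integrable_rhoM.
- by have := integrableZl measurableT C rho_int.
- by move=> xi _; rewrite mulrC ler_wpM2r//; exact: enormV_le.
Qed.

Lemma sublinearB F G a : sublinear F -> sublinear G ->
  sublinear (fun xi => F xi - a * G xi).
Proof.
move=> [mF [C C0 FC]] [mG [D D0 GD]]; split.
  by apply: measurable_funB => //; exact: measurable_funM.
exists (C + `|a| * D) => [|xi]; first by rewrite addr_ge0 ?mulr_ge0.
by rewrite (le_trans (ler_normB _ _))// mulrDl lerD// normrM -mulrA ler_wpM2l.
Qed.

Lemma avgB i F G a : sublinear F -> sublinear G ->
  avg i (fun xi => F xi - a * G xi) = avg i F - a * avg i G.
Proof.
move=> sF sG; rewrite /avg mulrCA -mulrBr; congr (_ * _).
rewrite -RintegralZl//; last exact: integrable_kern.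
rewrite -RintegralB//; last 2 first.
- exact: integrable_kern.
- by have := integrableZl measurableT a (integrable_kern i sG).
by apply: eq_Rintegral => xi _; rewrite /kern; ring.
Qed.

Lemma sublinear_increment f x : bsmooth f -> sublinear (increment f x).
Proof.
move=> fs; split; first exact: measurable_increment.
by have [L L0 fL] := bsmooth_lipschitz fs; exists L => //; exact: fL.
Qed.

Definition nonlocal_partial i f x := avg i (increment f x).

Local Notation T := nonlocal_partial.

(** By linearity of [avg], the difference between the increment of [T i f] and
    its expected derivative is the mean of second-order increments, to which
    [increment_second_order] applies. *)
Lemma nonlocal_partial_derive i j f x : bsmooth f ->
  derivable (T i f) x (e_ j) /\ 'd_ j (T i f) x = T i ('d_ j f) x.
Proof.
move=> fs; have [C C0 fC] := increment_second_order j fs.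
apply: (@quadratic_remainder_derive _ _ _ _ _ _ (n%:R * C)) => h.
have sf y := sublinear_increment y fs.
have sdf y := sublinear_increment y (bsmooth_partial j fs).
rewrite -[X in _ - X - _]mul1r -avgB// -avgB//; last first.
  exact: sublinearB.
rewrite -mulrA; apply: avg_bound.
- by have [] := sublinearB h (sublinearB 1 (sf (h *: e_ j + x)) (sf x)) (sdf x).
- by rewrite mulr_ge0// sqr_ge0.
- by move=> xi; rewrite mul1r.
Qed.

Lemma nonlocal_partial_bounded i f : bsmooth f ->
  exists B, forall x, `|T i f x| <= B.
Proof.
move=> fs; have [L L0 fL] := bsmooth_lipschitz fs.
by exists (n%:R * L) => x; apply: avg_bound => //; [exact: measurable_increment|exact: fL].
Qed.

Lemma pderivs_nonlocal_partial i s f : bsmooth f ->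
  pderivs s (T i f) = T i (pderivs s f).
Proof.
move=> fs; elim: s => //= j s ->.
by apply/funext => x; have [_ ->] := nonlocal_partial_derive i j x (bsmooth_pderivs s fs).
Qed.

Lemma bsmooth_nonlocal_partial i f : bsmooth f -> bsmooth (T i f).
Proof.
move=> fs s; rewrite pderivs_nonlocal_partial//; split.
  exact/nonlocal_partial_bounded/bsmooth_pderivs.
by move=> j x; have [] := nonlocal_partial_derive i j x (bsmooth_pderivs s fs).
Qed.

Hypotheses (n_gt0 : (0 < n)%N) (rho_radial : radial rho).

(** This is where radiality is used: on linear functions [avg i] picks the
    [i]-th coefficient, by [second_moment]. *)
Lemma avg_linear_part i (a : 'I_n -> R) :
  avg i (fun xi => \sum_(j < n) xi 0 j * a j) = a i.
Proof.
have iM j : mu.-integrable setT (EFin \o (fun xi => rho xi * (dir i xi * dir j xi) * a j)).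
  apply: (@integrable_le_cM _ _ rho _ `|a j|) => //.
    apply: measurable_funM => //; apply: measurable_funM => //.
    by apply: measurable_funM; exact: measurable_dir.
  move=> xi; rewrite normrM mulrC ler_wpM2l// normrM ger0_norm// ler_piMr//.
  by rewrite normrM mulr_ile1// dir_le1.
have iM' j : mu.-integrable setT (EFin \o (fun xi => rho xi * (dir i xi * dir j xi))).
  apply: (@integrable_le_cM _ _ rho _ 1) => //.
    apply: measurable_funM => //; apply: measurable_funM => //; exact: measurable_dir.
  move=> xi; rewrite mul1r normrM ger0_norm// ler_piMr//.
  by rewrite normrM mulr_ile1// dir_le1.
rewrite /avg.
under eq_Rintegral => xi _.
  rewrite /kern !mulr_sumr.
  under eq_bigr => j _.
    rewrite (_ : _ * _ = rho xi * (dir i xi * dir j xi) * a j); last by rewrite /dir; ring.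
    over.
  over.
rewrite Rintegral_sum_rV// mulr_sumr (eq_bigr (fun j => (i == j)%:R * a j)); last first.
  by move=> j _; rewrite RintegralZr// mulrA second_moment// rho1 mulr1.
rewrite (bigD1 i)//= eqxx mul1r big1 ?addr0// => j ji.
by rewrite eq_sym (negbTE ji) mul0r.
Qed.

Definition remainder f x xi := increment f x xi - \sum_(j < n) xi 0 j * 'd_ j f x.

Lemma sublinear_linear (a : 'I_n -> R) : sublinear (fun xi => \sum_(j < n) xi 0 j * a j).
Proof.
split.
  by apply: measurable_sum => j; apply: measurable_funM => //; exact: measurable_coord.
exists (\sum_j `|a j|) => [|xi]; first by apply: sumr_ge0.
rewrite (le_trans (ler_norm_sum _ _ _))// mulr_suml ler_sum// => j _.
by rewrite normrM mulrC ler_wpM2l// coord_le_enorm.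
Qed.

Lemma sublinear_remainder f x : bsmooth f -> sublinear (remainder f x).
Proof.
move=> fs.
have := sublinearB 1 (sublinear_increment x fs) (sublinear_linear (fun j => 'd_ j f x)).
by under [X in sublinear X]eq_fun do rewrite mul1r.
Qed.

Lemma nonlocal_partial_error i f x : bsmooth f ->
  T i f x - 'd_ i f x = avg i (remainder f x).
Proof.
move=> fs; rewrite -[X in _ - X](avg_linear_part i (fun j => 'd_ j f x)) -[X in _ - X]mul1r.
rewrite -avgB; [|exact: sublinear_increment|exact: sublinear_linear].
by congr avg; apply/funext => xi; rewrite mul1r.
Qed.

End fixed_kernel.

(** For large [xi] the bound comes from the Lipschitz estimate, for small [xi]
    from the Taylor estimate. *)
Lemma remainder_bound f : bsmooth f ->
  exists2 BM : R * R, 0 <= BM.1 /\ 0 <= BM.2 & forall x xi,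
    (enorm xi)^-1 * `|remainder f x xi| <= Num.min BM.1 (BM.2 * enorm xi).
Proof.
move=> fs; have [M M0 fM] := bsmooth_taylor fs.
have [L L0 fL] := bsmooth_lipschitz fs.
have /choice[B fB] : forall i, exists B, 0 <= B /\ forall x, `|'d_ i f x| <= B.
  by move=> i; have [B] := bsmooth_bounded (bsmooth_partial i fs); exists B.
have sB : 0 <= \sum_i B i by apply: sumr_ge0 => i _; case: (fB i).
exists (L + \sum_i B i, M); first by rewrite /= addr_ge0.
move=> x xi; rewrite le_min /=; apply/andP; split; apply: enormV_le.
- exact: addr_ge0.
- rewrite mulrDl (le_trans (ler_normB _ _))//; apply: lerD; first exact: fL.
  rewrite (le_trans (ler_norm_sum _ _ _))// mulr_suml ler_sum// => j _.
  by rewrite normrM mulrC ler_pM ?coord_le_enorm//; case: (fB j).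
- by rewrite mulr_ge0// enorm_ge0.
- by rewrite -mulrA -expr2; exact: fM.
Qed.

End scalar_operator.

(** * Error estimates *)

Section error_estimates.
Context {R : realType} {n : nat}.
Local Notation mu := (lebesgue_rV R n).
Implicit Types (f F G : 'rV[R]_n -> R) (x y v xi : 'rV[R]_n).

Local Notation e_ i := (delta_mx 0 i : 'rV[R]_n).
Local Notation "'d_ i f" := ('D_(e_ i) f) (at level 10, i at level 8, f at level 8).

Lemma L1_le_cube f B r : continuous f -> 0 <= B -> 0 <= r ->
  (forall x, `|f x| <= B) -> (forall x, ~ cube 0 r x -> f x = 0) ->
  (\int[mu]_x `|f x|%:E <= (B * (r *+ 2) ^+ n)%:E)%E.
Proof.
move=> fc B0 r0 fB f0; have mc := measurable_cube (0 : 'rV[R]_n) r.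
apply: (@le_trans _ _ (\int[mu]_x (B%:E * (\1_(cube 0 r) x)%:E))%E).
  apply: ge0_le_integral => //.
  - apply/measurable_EFinP; apply: measurableT_comp => //.
    exact: continuous_measurable_rV.
  - by apply: emeasurable_funM => //; exact/measurable_EFinP/measurable_indic.
  - move=> x _; rewrite -EFinM lee_fin indicE; have [xr|nx] := pselect (cube 0 r x).
      by rewrite mem_set// mulr1.
    by rewrite memNset// mulr0 f0// normr0.
rewrite ge0_integralZl//; last exact/measurable_EFinP/measurable_indic.
by rewrite integral_indic// setIT [X in (_ * X)%E](lebesgue_rV_cube 0 r0) -EFinM.
Qed.

(** A pair of constants [BM = (B, M)] is kept together so that it can be chosen
    at once for every coordinate and every derivative. *)
Definition modulus (BM : R * R) xi := Num.min BM.1 (BM.2 * enorm xi).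

Lemma modulus_ge0 BM xi : 0 <= BM.1 -> 0 <= BM.2 -> 0 <= modulus BM xi.
Proof. by move=> B0 M0; rewrite le_min B0 mulr_ge0 ?enorm_ge0. Qed.

Lemma measurable_modulus BM : measurable_fun setT (modulus BM).
Proof.
apply: measurable_minr => //; apply: measurable_funM => //.
exact: measurable_enorm.
Qed.

Lemma measurable_eball r : measurable (@eball R n r).
Proof.
rewrite /eball (_ : [set _ | _] = @enorm R n @^-1` `]-oo, r[).
  by rewrite -[X in measurable X]setTI; exact: measurable_enorm.
by apply/seteqP; split => x /=; rewrite in_itv.
Qed.

Lemma measurable_remainder f : bsmooth f ->
  measurable_fun setT (fun p : 'rV[R]_n * 'rV[R]_n => remainder f p.1 p.2).
Proof.
move=> fs; have mf (g : 'rV[R]_n -> R) : bsmooth g -> measurable_fun setT g.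
  by move=> gs; apply: continuous_measurable_rV; exact: bsmooth_continuous.
have mc j : measurable_fun setT (fun x : 'rV[R]_n => x 0 j) by exact: measurable_coord.
apply: measurable_funB.
  apply: measurable_funB.
    have ma : measurable_fun setT (fun p : 'rV[R]_n * 'rV[R]_n => p.1 + p.2).
      apply: measurable_fun_mxP => i j.
      under eq_fun do rewrite mxE.
      apply: measurable_funD; rewrite ord1; exact: (measurableT_comp (mc j)).
    exact: (measurableT_comp (mf _ fs) ma).
  exact: (measurableT_comp (mf _ fs)).
apply: measurable_sum => j; apply: measurable_funM.
  exact: (measurableT_comp (mc j)).
exact: (measurableT_comp (mf _ (bsmooth_partial j fs))).
Qed.

Section fixed_kernel.
Variable rho : 'rV[R]_n -> R.
Hypotheses (rho_int : mu.-integrable setT (EFin \o rho))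
  (rho_ge0 : forall x, 0 <= rho x) (rho1 : \int[mu]_x rho x = 1)
  (n_gt0 : (0 < n)%N) (rho_radial : radial rho).

Let m_rho : measurable_fun setT rho.
Proof. by apply/measurable_EFinP; exact: measurable_int rho_int. Qed.

Local Notation T := (nonlocal_partial rho).

Definition mean_modulus BM := \int[mu]_xi (rho xi * modulus BM xi).

Lemma integrable_modulus BM : 0 <= BM.1 -> 0 <= BM.2 ->
  mu.-integrable setT (EFin \o (fun xi => rho xi * modulus BM xi)).
Proof.
move=> B0 M0; apply: (@integrable_le_cM _ _ rho _ BM.1) => //.
  by apply: measurable_funM => //; exact: measurable_modulus.
move=> xi; rewrite ger0_norm ?mulr_ge0 ?modulus_ge0// mulrC ler_wpM2r//.
by rewrite ge_min lexx.
Qed.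

Lemma mean_modulus_ge0 BM : 0 <= BM.1 -> 0 <= BM.2 -> 0 <= mean_modulus BM.
Proof.
by move=> B0 M0; apply: Rintegral_ge0 => xi _; rewrite mulr_ge0// modulus_ge0.
Qed.

(** Inside the ball of radius [delta] the modulus is at most [BM.2 * delta],
    outside at most [BM.1]. *)
Lemma mean_modulus_le BM delta : 0 <= BM.1 -> 0 <= BM.2 -> 0 < delta ->
  mean_modulus BM <= BM.2 * delta + BM.1 * fine (L1norm (~` eball delta) rho).
Proof.
move=> B0 M0 d0.
have mD : measurable (~` @eball R n delta) by apply: measurableC; exact: measurable_eball.
have iD : mu.-integrable setT (EFin \o (rho \_ (~` eball delta))).
  rewrite -restrict_EFin; apply/(integrable_mkcond _ mD).
  exact: integrableS rho_int.
have E : fine (L1norm (~` eball delta) rho) = \int[mu]_x (rho \_ (~` eball delta)) x.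
  rewrite -Rintegral_mkcond; congr fine; apply: eq_integral => x _.
  by rewrite ger0_norm.
rewrite E -[BM.2 * delta]mulr1 -rho1 -!RintegralZl// -RintegralD//; last 2 first.
- by have := integrableZl measurableT (BM.2 * delta) rho_int.
- by have := integrableZl measurableT BM.1 iD.
apply: le_Rintegral => //.
- exact: integrable_modulus.
- have := integrableD measurableT (integrableZl measurableT (BM.2 * delta) rho_int)
   (integrableZl measurableT BM.1 iD).
  by apply: eq_integrable.
- move=> xi _; rewrite patchE.
  case: ifPn => [|xd].
    rewrite inE /= => /negP; rewrite -leNgt => dxi.
    rewrite ler_wpDl ?mulr_ge0// ?(ltW d0)// mulrC ler_wpM2r//.
    by rewrite ge_min lexx.
  move: xd; rewrite notin_setE /= => /contrapT; rewrite /eball /= => xd.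
  rewrite mulr0 addr0 mulrC ler_wpM2r// ge_min; apply/orP; right.
  by rewrite ler_wpM2l// ltW.
Qed.

Variables (f : 'rV[R]_n -> R) (BM : R * R) (r : R) (i : 'I_n).
Hypotheses (fs : bsmooth f) (B0 : 0 <= BM.1) (M0 : 0 <= BM.2)
  (f_rem : forall x xi, (enorm xi)^-1 * `|remainder f x xi| <= modulus BM xi).

Lemma error_sup x : `|T i f x - 'd_ i f x| <= n%:R * mean_modulus BM.
Proof.
have sr := sublinear_remainder x fs.
rewrite nonlocal_partial_error// (le_trans (avg_norm _ _ _ sr))// ler_wpM2l//.
apply: le_Rintegral => //.
- exact: integrable_rhoM.
- exact: integrable_modulus.
- by move=> xi _; rewrite ler_wpM2l.
Qed.

Hypotheses (r0 : 0 <= r) (f0 : forall x, ~ cube 0 r x -> f x = 0)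
  (df0 : forall j x, ~ cube 0 r x -> 'd_ j f x = 0).

(** Tonelli: for fixed [xi] the remainder vanishes unless [x] or [x + xi] is in
    the cube, that is, unless [x] is in a union of two cubes of the same volume. *)
Lemma error_L1 : (\int[mu]_x (`|T i f x - 'd_ i f x|)%:E <=
  (n%:R * mean_modulus BM * (2 * (r *+ 2) ^+ n))%:E)%E.
Proof.
pose k (p : 'rV[R]_n * 'rV[R]_n) := rho p.2 * ((enorm p.2)^-1 * `|remainder f p.1 p.2|).
have k0 p : 0 <= k p by rewrite !mulr_ge0// invr_ge0 enorm_ge0.
have mk : measurable_fun setT k.
  apply: measurable_funM; first exact: measurableT_comp.
  apply: measurable_funM.
    exact: (measurableT_comp measurable_enormV).
  by apply: measurableT_comp => //; exact: measurable_remainder.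
have mkE : measurable_fun setT (EFin \o k) by exact/measurable_EFinP.
have k0E p : (0 <= (EFin \o k) p)%E by rewrite lee_fin.
have mE : measurable_fun setT (fun x => `|T i f x - 'd_ i f x|).
  apply: measurableT_comp => //; apply: measurable_funB.
    apply: (continuous_measurable_rV (bsmooth_continuous _)).
    exact: (bsmooth_nonlocal_partial rho_int rho_ge0 rho1 i fs).
  exact: (continuous_measurable_rV (bsmooth_continuous (bsmooth_partial i fs))).
apply: (@le_trans _ _ (\int[mu]_x (n%:R%:E * \int[mu]_xi (k (x, xi))%:E))%E).
  apply: ge0_le_integral => //.
  - exact/measurable_EFinP.
  - by apply: emeasurable_funM => //; exact: (measurable_fun_fubini_tonelli_F (EFin \o k)).
  - move=> x _; rewrite nonlocal_partial_error//.
    have sr := sublinear_remainder x fs.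
    apply: (le_trans (y := (n%:R * \int[mu]_xi (k (x, xi)))%:E)).
      by rewrite lee_fin; exact: avg_norm.
    rewrite EFinM lee_pmul// ?lee_fin ?Rintegral_ge0// /Rintegral fineK//.
    exact/integrable_fin_num/integrable_rhoM.
rewrite ge0_integralZl//; last 2 first.
- exact: (measurable_fun_fubini_tonelli_F (EFin \o k)).
- by move=> x _; apply: integral_ge0 => xi _; exact: k0E.
rewrite -mulrA EFinM lee_pmul//.
  by apply: integral_ge0 => x _; apply: integral_ge0 => xi _; exact: k0E.
rewrite (fubini_tonelli (EFin \o k))//.
pose V : R := 2 * (r *+ 2) ^+ n.
have V0 : 0 <= V by rewrite mulr_ge0// exprn_ge0// mulrn_wge0.
apply: (@le_trans _ _ (\int[mu]_xi (V%:E * (rho xi * modulus BM xi)%:E))%E).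
  apply: ge0_le_integral => //.
  - by move=> xi _; apply: integral_ge0 => x _; exact: k0E.
  - exact: (measurable_fun_fubini_tonelli_G (EFin \o k)).
  - apply: emeasurable_funM => //; apply/measurable_EFinP; apply: measurable_funM => //.
    exact: measurable_modulus.
  move=> xi _; pose S : set 'rV[R]_n := cube 0 r `|` cube (- xi) r.
  have mS : measurable S by apply: measurableU; exact: measurable_cube.
  have muS : (mu S <= V%:E)%E.
    have : (mu S <= mu (cube 0 r) + mu (cube (- xi) r))%E.
      by apply: measureU2; exact: measurable_cube.
    by rewrite !lebesgue_rV_cube// -EFinD /V mulr_natl mulr2n.
  apply: (@le_trans _ _ (\int[mu]_x ((rho xi * modulus BM xi)%:E * (\1_S x)%:E))%E).
    apply: ge0_le_integral => //.
    - by apply/measurable_EFinP; exact: (measurableT_comp mk).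
    - by apply: emeasurable_funM => //; apply/measurable_EFinP.
    - move=> x _; rewrite -EFinM lee_fin indicE.
      case: (pselect (S x)) => [Sx|nSx].
        by rewrite mem_set// mulr1 ler_wpM2l.
      rewrite memNset// mulr0 /k /= /remainder /increment.
      have [n1 n2] : ~ cube 0 r x /\ ~ cube (- xi) r x.
        by split=> h; apply: nSx; [left|right].
      rewrite (f0 n1) f0; last first.
        apply: contra_not n2 => h j; have := h j.
        by rewrite /ball/= !mxE sub0r normrN -opprD normrN addrC.
      rewrite big1 ?subrr ?normr0 ?mulr0// => j _.
      by rewrite df0// mulr0.
  have q0 : (0 <= (rho xi * modulus BM xi)%:E)%E by rewrite lee_fin mulr_ge0// modulus_ge0.
  rewrite ge0_integralZl//; last exact/measurable_EFinP/measurable_indic.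
  by rewrite integral_indic// setIT muleC; exact: lee_wpmul2r.
have mq : measurable_fun setT (fun xi => (rho xi * modulus BM xi)%:E).
  by apply/measurable_EFinP; apply: measurable_funM => //; exact: measurable_modulus.
rewrite ge0_integralZl//; last first.
  by move=> xi _; rewrite lee_fin mulr_ge0// modulus_ge0.
rewrite (EFinM (mean_modulus BM)) /mean_modulus /Rintegral fineK 1?muleC//.
exact/integrable_fin_num/integrable_modulus.
Qed.

End fixed_kernel.
End error_estimates.

(** * Limits and Lebesgue norms *)

Section limits.
Context {R : realType} {n : nat}.
Local Notation mu := (lebesgue_rV R n).

Lemma mean_modulus_cvg0 (rho : R -> 'rV[R]_n -> R) (BM : R * R) :
  (forall eps, 0 < eps -> mu.-integrable setT (EFin \o rho eps)) ->
  (forall eps x, 0 < eps -> 0 <= rho eps x) ->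
  (forall eps, 0 < eps -> \int[mu]_x rho eps x = 1) ->
  (forall delta, 0 < delta ->
    L1norm (~` eball delta) (rho eps) @[eps --> 0^'+] --> 0%E) ->
  0 <= BM.1 -> 0 <= BM.2 ->
  mean_modulus (rho eps) BM @[eps --> 0^'+] --> 0.
Proof.
move=> irho rho0 rho1 crho B0 M0; apply/cvgrPdist_le => e e0.
have B1 : 0 < BM.1 + 1 by rewrite ltr_wpDl.
have M1 : 0 < BM.2 + 1 by rewrite ltr_wpDl.
(* The ball contributes at most [e / 2]; the outside does so for small [eps]. *)
pose delta := e / 2 / (BM.2 + 1).
have d0 : 0 < delta by rewrite !divr_gt0.
have /fine_cvgP[_ /cvgrPdist_le cL] := crho _ d0.
have b0 : 0 < e / 2 / (BM.1 + 1) by rewrite !divr_gt0.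
near=> eps; have eps0 : 0 < eps by [].
rewrite sub0r normrN ger0_norm; last first.
  by apply: mean_modulus_ge0 => // x; exact: rho0.
have rho0' x : 0 <= rho eps x by exact: rho0.
rewrite (le_trans (mean_modulus_le (irho _ eps0) rho0' (rho1 _ eps0) B0 M0 d0))//.
rewrite [leRHS](splitr e) lerD//.
  rewrite /delta mulrCA ler_piMr ?divr_ge0 ?(ltW e0)//.
  by rewrite ler_pdivrMr// mul1r lerDl.
rewrite (@le_trans _ _ (BM.1 * (e / 2 / (BM.1 + 1))))//.
  rewrite ler_wpM2l//; apply: le_trans (ler_norm _) _.
  rewrite -normrN -sub0r; near: eps; exact: (cL _ b0).
rewrite mulrCA ler_piMr ?divr_ge0 ?(ltW e0)//.
by rewrite ler_pdivrMr// mul1r lerDl.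
Unshelve. all: by end_near. Qed.

(** For finite [p], [|g|^p <= c^(p-1) |g|] and [K^(1/p) <= K]. *)
Lemma Lnorm_le (p : \bar R) (g : 'rV[R]_n -> R) (c K : R) :
  (1 <= p)%E -> measurable_fun setT g -> 0 <= c -> 1 <= K ->
  (forall x, `|g x| <= c) -> (\int[mu]_x `|g x|%:E <= (c * K)%:E)%E ->
  (Lnorm mu p (EFin \o g) <= (c * K)%:E)%E.
Proof.
move=> p1 mg c0 K1 gc intg; rewrite unlock /Lnorm.
have K0 : 0 <= K by exact: le_trans K1.
case: p p1 => [q||//].
  rewrite lee_fin => q1.
  have q0 : 0 < q by exact: lt_le_trans q1.
  have mgq : measurable_fun setT (fun x => (`|g x| `^ q)%:E).
    apply/measurable_EFinP.
    by apply: (measurableT_comp (measurable_powR q)); exact: measurableT_comp.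
  have H : (\int[mu]_x (`|g x| `^ q)%:E <= (c `^ q * K)%:E)%E.
    apply: (@le_trans _ _ (\int[mu]_x ((c `^ (q - 1))%:E * `|g x|%:E))%E).
      apply: ge0_le_integral => //.
      - apply: emeasurable_funM => //; apply/measurable_EFinP; exact: measurableT_comp.
      - move=> x _; rewrite -EFinM lee_fin -mulr_powRB1// mulrC ler_wpM2r//.
        by rewrite ge0_ler_powR ?nnegrE// subr_ge0.
    rewrite ge0_integralZl//; last 2 first.
    - by apply/measurable_EFinP; exact: measurableT_comp.
    - by rewrite lee_fin powR_ge0.
    rewrite (_ : c `^ q * K = c `^ (q - 1) * (c * K)); last by rewrite -mulr_powRB1//; ring.
    by rewrite EFinM lee_wpmul2l// lee_fin powR_ge0.
  apply: (@le_trans _ _ (((c `^ q * K)%:E `^ q^-1)%E)).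
    apply: gt0_ler_poweR => //.
    - by rewrite invr_ge0 ltW.
    - by rewrite in_itv /= leey andbT; apply: integral_ge0 => x _; rewrite lee_fin powR_ge0.
    - by rewrite in_itv/= leey andbT lee_fin mulr_ge0// powR_ge0.
  rewrite poweR_EFin lee_fin powRM ?powR_ge0// -powRrM mulfV ?gt_eqF// powRr1//.
  rewrite ler_wpM2l// -[leRHS]powRr1// ler_powR// invf_le1//.
move=> _; case: ifPn => [_|_]; last by rewrite lee_fin mulr_ge0.
apply/ess_supP; apply/nearW => x /=.
by rewrite lee_fin (le_trans (gc x))// ler_peMr.
Qed.

(** Dominated convergence; the integrand vanishes at the origin, the only point
    that no truncation reaches. *)
Lemma truncated_kern_cvg (rho : 'rV[R]_n -> R) i (F : 'rV[R]_n -> R) :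
  mu.-integrable setT (EFin \o rho) -> (forall x, 0 <= rho x) ->
  sublinear F ->
  \int[mu]_(xi in ~` eball delta) kern rho i F xi @[delta --> 0^'+] -->
    \int[mu]_xi kern rho i F xi.
Proof.
move=> irho rho0 sF; apply/cvg_at_rightP => u [u0 ucvg].
under eq_fun do rewrite Rintegral_mkcond.
have mrho : measurable_fun setT rho by apply/measurable_EFinP; exact: measurable_int irho.
have mk : measurable_fun setT (kern rho i F) by apply: measurable_kern => //; case: sF.
pose g m := kern rho i F \_ (~` eball (u m)).
have ik := integrable_kern irho rho0 i sF.
have [|||||_ _] := @dominated_convergence _ _ _ mu setT measurableT
  (fun m => EFin \o g m) (EFin \o kern rho i F) (EFin \o (fun xi => `|kern rho i F xi|)).
- move=> m; apply/measurable_EFinP.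
  apply/(measurable_restrictT _ (measurableC (measurable_eball (u m)))).
  exact: measurable_funTS.
- exact/measurable_EFinP.
- apply: aeW => xi _; apply: cvg_EFin; first exact: nearW.
  apply: cvg_near_cst.
  have [xi0|xi0] := eqVneq xi 0.
    apply: nearW => m; rewrite /g /= patchE; case: ifP => // _.
    by rewrite /kern /dir xi0 mxE mulr0 mul0r mulr0.
  have exi : 0 < enorm xi by rewrite lt0r enorm_eq0 xi0 enorm_ge0.
  near=> m; rewrite /g /= patchE mem_set// /eball /=.
  apply/negP; rewrite -leNgt ltW//.
  near: m; exact: (cvgr_lt _ ucvg).
- by have := integrable_norm ik.
- apply: aeW => xi m _; rewrite /= lee_fin /g patchE.
  by case: ifP => // _; rewrite normr0.
move=> H; apply: fine_cvg.
by rewrite /Rintegral fineK//; exact: integrable_fin_num.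
Unshelve. all: by end_near. Qed.

End limits.

(** * Coordinates in an inner product space *)

Section inner_coordinates.
Context {R : realType} {V : finInnerType R}.
Local Notation d := (\dim {:V}).
Local Notation b := (vbasis {:V}).

(** Expresses the inner product through the norm, whose continuity is known. *)
Lemma polarization (v e : V) :
  inner v e = (`|v + e| ^+ 2 - `|v| ^+ 2 - `|e| ^+ 2) / 2.
Proof.
have sym : inner e v = inner v e by rewrite hermC /= expr0 mul1r.
have -> : `|v + e| ^+ 2 = `|v| ^+ 2 + inner v e + (inner v e + `|e| ^+ 2).
  by rewrite -!inner_sqr_norm (linearDl inner) !(linearDr inner); congr (_ + (_ + _)).
by field.
Qed.

Lemma continuous_inner (e : V) : continuous (fun v : V => inner v e : R).
Proof.
have sq (u : V -> V) : continuous u -> continuous (fun v => `|u v| ^+ 2 : R).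
  move=> cu v; apply: (@continuous_comp _ _ _ (fun v => `|u v|) (fun t : R => t ^+ 2)).
    by apply: (@continuous_comp _ _ _ u Num.norm); [exact: cu|exact: norm_continuous].
  exact: exprn_continuous.
under eq_fun do rewrite polarization.
move=> v; apply: cvgMl; apply: cvgB; last exact: cvg_cst.
apply: cvgB; last by apply: (sq id) => ?; exact: cvg_id.
by apply: (sq (fun v => v + e)) => ?; apply: cvgD; [exact: cvg_id|exact: cvg_cst].
Qed.

Definition gram : 'M[R]_d := \matrix_(i, j) inner b`_i b`_j.

Lemma gram_coord (v : V) (j : 'I_d) :
  inner v b`_j = \sum_(i < d) coord b i v * gram i j.
Proof.
rewrite {1}(coord_vbasis (memvf v)) linear_sumlz /=.
by apply: eq_bigr => i _; rewrite linearZl_LR /= mxE.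
Qed.

(** A vector orthogonal to a basis is orthogonal to itself. *)
Lemma gram_unit : gram \in unitmx.
Proof.
rewrite -row_free_unit; apply: inj_row_free => c cG.
pose v : V := \sum_(i < d) c 0 i *: b`_i.
have cv (i : 'I_d) : coord b i v = c 0 i.
  by rewrite /v coord_sum_free//; exact: basis_free (vbasisP _).
have vb (j : 'I_d) : inner v b`_j = 0.
  rewrite gram_coord; transitivity ((c *m gram) 0 j); last by rewrite cG mxE.
  by rewrite mxE; apply: eq_bigr => i _; rewrite cv.
have : inner v v = 0.
  rewrite {2}(coord_vbasis (memvf v)) linear_sumr big1// => i _.
  by rewrite linearZr_LR /= vb mulr0.
rewrite inner_sqr_norm => /eqP; rewrite sqrf_eq0 normr_eq0 => /eqP v0.
by apply/rowP => i; rewrite -cv v0 linear0 mxE.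
Qed.

(** Inverting the Gram matrix expresses coordinates in an arbitrary basis
    through inner products, which makes them continuous. *)
Lemma coord_inner (k : 'I_d) (v : V) :
  coord b k v = \sum_(j < d) inner v b`_j * invmx gram j k.
Proof.
pose c : 'rV[R]_d := \row_i coord b i v.
have : c *m gram = \row_j inner v b`_j.
  by apply/rowP => j; rewrite !mxE gram_coord; apply: eq_bigr => i _; rewrite mxE.
move/(congr1 (mulmx^~ (invmx gram))); rewrite mulmxK ?gram_unit// => /rowP/(_ k).
by rewrite !mxE => ->; apply: eq_bigr => j _; rewrite mxE.
Qed.

Lemma continuous_coord (k : 'I_d) : continuous (coord b k : V -> R).
Proof.
rewrite (_ : (coord b k : V -> R) = fun v => \sum_(j < d) inner v b`_j * invmx gram j k).
  apply: continuous_big => [|j _]; first exact: add_continuous.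
  by move=> v; apply: cvgMl; exact: continuous_inner.
by apply/funext => v; rewrite -coord_inner.
Qed.

End inner_coordinates.

(** * Vector-valued test functions *)

Section vector_test_functions.
Context {R : realType} {n : nat}.
Local Notation e_ i := (delta_mx 0 i : 'rV[R]_n).

Section coordinates.
Context {V : finInnerType R}.
Local Notation b := (vbasis {:V}).
Implicit Types phi : 'rV[R]_n -> V.

Definition comp_coord (k : 'I_(\dim {:V})) phi (x : 'rV[R]_n) : R := coord b k (phi x).

Lemma coord_derive k phi x v : derivable phi x v ->
  derivable (comp_coord k phi) x v /\
  'D_v (comp_coord k phi) x = coord b k ('D_v phi x).
Proof.
move=> dphi.
have H : h^-1 *: ((comp_coord k phi \o shift x) (h *: v) - comp_coord k phi x) @[h --> 0^'] -->
   coord b k ('D_v phi x).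
  rewrite (_ : (fun h => _) = coord b k \o
    (fun h : R => h^-1 *: ((phi \o shift x) (h *: v) - phi x))); last first.
    by apply/funext => h; rewrite /comp_coord /= [RHS]linearZ [in RHS]linearB.
  by apply: continuous_cvg; [exact: continuous_coord|exact: dphi].
by split; [apply/cvg_ex; eexists; exact: H|exact: cvg_lim].
Qed.

Lemma pderivs_coord k phi s : smooth phi ->
  pderivs s (comp_coord k phi) = comp_coord k (iter_partial s phi).
Proof.
move=> phis; elim: s => //= i s ->; apply/funext => x.
by rewrite (coord_derive k ((phis s).2 i x)).2.
Qed.

Lemma iter_partial_supp phi s x : ~ supp phi x -> iter_partial s phi x = 0.
Proof.
elim: s x => [|i s IHs] x nx.
  by apply: contrapT => /eqP px; apply: nx; exact: subset_closure.
transitivity ('D_(e_ i) (cst 0 : 'rV[R]_n -> V) x); last exact: derive_cst.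
apply: near_eq_derive.
have oS : open (~` supp phi) by apply: closed_openC; exact: closed_closure.
have := open_nbhs_nbhs (conj oS nx); apply: filterS => y; exact: IHs.
Qed.

Lemma compact_in_cube (K : set 'rV[R]_n) : compact K -> exists2 r, 0 <= r & K `<=` cube 0 r.
Proof.
move=> cK; have := continuous_compact (continuous_subspaceT (@continuous_enorm R n)) cK.
move=> /compact_bounded/pinfty_ex_gt0[M M0 KM]; exists (M + 1); first by rewrite addr_ge0// ltW.
move=> x Kx i; rewrite /ball/= mxE sub0r normrN (le_lt_trans (coord_le_enorm x i))//.
rewrite (@le_lt_trans _ _ M) ?ltrDl//.
by have := KM (enorm x) (ex_intro2 _ _ x Kx erefl); rewrite /= ger0_norm ?enorm_ge0.
Qed.

Lemma bsmooth_coord k phi : test_function phi -> bsmooth (comp_coord k phi).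
Proof.
move=> [phis phic] s; rewrite pderivs_coord//; split; last first.
  by move=> i x; have [] := coord_derive k ((phis s).2 i x).
have cg : continuous (comp_coord k (iter_partial s phi)).
  move=> x; apply: (@continuous_comp _ _ _ (iter_partial s phi) (coord b k)).
    exact: (phis s).1.
  exact: continuous_coord.
have := continuous_compact (continuous_subspaceT cg) phic.
move=> /compact_bounded/pinfty_ex_gt0[M M0 KM]; exists M => x.
have [sx|nx] := pselect (supp phi x).
  by apply: KM; exists x.
by rewrite /comp_coord iter_partial_supp// linear0 normr0 ltW.
Qed.

Lemma coord_supp r k phi s : test_function phi -> supp phi `<=` cube 0 r ->
  forall x, ~ cube 0 r x -> pderivs s (comp_coord k phi) x = 0.
Proof.
move=> [phis _] sr x nx; rewrite pderivs_coord// /comp_coord iter_partial_supp ?linear0//.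
by move=> /sr.
Qed.

End coordinates.

Section combinations.
Context {W : finInnerType R} {P : finType}.
Implicit Types (g : P -> 'rV[R]_n -> R) (w : P -> W).

Definition lincomb g w (x : 'rV[R]_n) : W := \sum_p g p x *: w p.

Lemma lincomb_derive g w x v : (forall p, derivable (g p) x v) ->
  derivable (lincomb g w) x v /\
  'D_v (lincomb g w) x = \sum_p 'D_v (g p) x *: w p.
Proof.
move=> dg.
have H : h^-1 *: ((lincomb g w \o shift x) (h *: v) - lincomb g w x) @[h --> 0^'] -->
   \sum_p 'D_v (g p) x *: w p.
  rewrite (_ : (fun h => _) = fun h : R => \sum_p
    (h^-1 *: ((g p \o shift x) (h *: v) - g p x)) *: w p); last first.
    apply/funext => h; rewrite /= /lincomb -sumrB scaler_sumr.
    by apply: eq_bigr => p _; rewrite -scalerBl scalerA.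
  apply: cvg_big => [|p _]; first exact: add_continuous.
  by apply: cvgZr_tmp; exact: dg.
by split; [apply/cvg_ex; eexists; exact: H|exact: cvg_lim].
Qed.

Lemma iter_partial_lincomb g w s : (forall p, bsmooth (g p)) ->
  iter_partial s (lincomb g w) = lincomb (fun p => pderivs s (g p)) w.
Proof.
move=> gs; elim: s => //= i s ->; apply/funext => x.
by rewrite (lincomb_derive w (fun p => (gs p s).2 i x)).2.
Qed.

Lemma continuous_lincomb g w : (forall p, continuous (g p)) -> continuous (lincomb g w).
Proof.
move=> gc; apply: continuous_big => [|p _]; first exact: add_continuous.
move=> x; have H : g p y @[y --> x] --> g p x by exact: gc.
have F0 : Filter (nbhs (x : 'rV[R]_n)) by exact: nbhs_filter.
exact: (cvgZr_tmp H).
Qed.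

Lemma smooth_lincomb g w : (forall p, bsmooth (g p)) -> smooth (lincomb g w).
Proof.
move=> gs s; rewrite iter_partial_lincomb//; split.
  by apply: continuous_lincomb => p; apply/bsmooth_continuous/bsmooth_pderivs.
by move=> i x; have [] := lincomb_derive w (fun p => (gs p s).2 i x).
Qed.

(** A compact set in which the supports can be confined; the open cubes [cube]
    are those with a convenient measure. *)
Definition closed_cube r : set 'rV[R]_n := [set x | forall i, `[- r, r]%classic (x 0 i)].

Lemma closed_cube_compact r : compact (closed_cube r).
Proof. by apply: (@rV_compact R n (fun=> `[- r, r]%classic)) => i; exact: segment_compact. Qed.

Lemma test_function_lincomb g w r : (forall p, bsmooth (g p)) ->
  (forall p x, ~ closed_cube r x -> g p x = 0) ->
  test_function_in (closed_cube r) (lincomb g w).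
Proof.
move=> gs g0.
have sK : supp (lincomb g w) `<=` closed_cube r.
  rewrite (closure_id (closed_cube r)).1; last first.
    by apply: compact_closed; [exact: norm_hausdorff|exact: closed_cube_compact].
  apply: closure_subset => x /= /eqP gx; apply: contrapT => nx; apply: gx.
  by rewrite /lincomb big1// => p _; rewrite g0// scale0r.
split=> //; split; first exact: smooth_lincomb.
apply: (subclosed_compact _ (@closed_cube_compact r)) => //.
exact: closed_closure.
Qed.

(** The triangle inequality in [W], both pointwise and under the integral. *)
Lemma vLnorm_lincomb (p : \bar R) g w (c : P -> R) K :
  (1 <= p)%E -> 1 <= K -> (forall q, continuous (g q)) ->
  (forall q, 0 <= c q) -> (forall q x, `|g q x| <= c q) ->
  (forall q, \int[lebesgue_rV R n]_x `|g q x|%:E <= (c q * K)%:E)%E ->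
  (vLnorm p (lincomb g w) <= ((\sum_q c q * `|w q|) * K)%:E)%E.
Proof.
move=> p1 K1 gc c0 gb gi.
have le_sum x : `|lincomb g w x| <= \sum_q `|w q| * `|g q x|.
  rewrite (le_trans (ler_norm_sum _ _ _))// ler_sum// => q _.
  by rewrite normrZ mulrC.
apply: Lnorm_le => //.
- apply: continuous_measurable_rV => x.
  apply: (@continuous_comp _ _ _ (lincomb g w) Num.norm); last exact: norm_continuous.
  exact: continuous_lincomb.
- by apply: sumr_ge0 => q _; exact: mulr_ge0.
- move=> x; rewrite normr_id (le_trans (le_sum x))// ler_sum// => q _.
  by rewrite mulrC ler_wpM2r.
have mg q : measurable_fun setT (fun x => `|g q x|).
  by apply: measurableT_comp => //; exact: continuous_measurable_rV.
apply: (@le_trans _ _ (\int[lebesgue_rV R n]_x \sum_q (`|w q|%:E * `|g q x|%:E))%E).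
  apply: ge0_le_integral => //.
  - apply/measurable_EFinP; apply: measurableT_comp => //.
    apply: continuous_measurable_rV => x.
    apply: (@continuous_comp _ _ _ (lincomb g w) Num.norm); last exact: norm_continuous.
    exact: continuous_lincomb.
  - apply: emeasurable_sum => q; apply: emeasurable_funM => //.
    exact/measurable_EFinP.
  - move=> x _; rewrite normr_id.
    under eq_bigr do rewrite -EFinM.
    by rewrite sumEFin lee_fin.
rewrite ge0_integral_sum//; last first.
  by move=> q; apply: emeasurable_funM => //; exact/measurable_EFinP.
rewrite mulr_suml -sumEFin; apply: lee_sum => q _.
rewrite ge0_integralZl//; last exact/measurable_EFinP.
by rewrite mulrAC mulrC EFinM lee_wpmul2l.
Qed.

End combinations.
End vector_test_functions.

(** * The operators in coordinates *)

Section operators_in_coordinates.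
Context {R : realType} {n : nat}.
Local Notation mu := (lebesgue_rV R n).
Local Notation e_ i := (delta_mx 0 i : 'rV[R]_n).

Lemma vintegral_lincomb (W : finInnerType R) (P : finType) (D : set 'rV[R]_n)
    (g : P -> 'rV[R]_n -> R) (w : P -> W) :
  measurable D -> (forall p, mu.-integrable D (EFin \o g p)) ->
  vintegral D (lincomb g w) = \sum_p (\int[mu]_(x in D) g p x) *: w p.
Proof.
move=> mD ig; rewrite /vintegral.
have -> : \sum_p (\int[mu]_(x in D) g p x) *: w p =
    \sum_p \sum_(l < \dim {:W})
      ((\int[mu]_(x in D) g p x) * coord (vbasis {:W}) l (w p)) *: (vbasis {:W})`_l.
  apply: eq_bigr => p _; rewrite {1}(coord_vbasis (memvf (w p))) scaler_sumr.
  by apply: eq_bigr => l _; rewrite scalerA.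
rewrite exchange_big /=; apply: eq_bigr => l _; rewrite -scaler_suml; congr (_ *: _).
under eq_Rintegral do rewrite linear_sum.
under eq_Rintegral => x _.
  under eq_bigr do rewrite linearZ /=.
  over.
rewrite (@Rintegral_sum_rV _ _ _ _ _ (fun p x => g p x * coord (vbasis {:W}) l (w p)))//.
  by apply: eq_bigr => p _; rewrite RintegralZr.
move=> p; have := integrableZr mD (coord (vbasis {:W}) l (w p)) (ig p).
by apply: eq_integrable.
Qed.

Context {V W : finInnerType R}.
Variables (A : 'I_n -> 'Hom(V, W)) (phi : 'rV[R]_n -> V).
Hypothesis phi_test : test_function phi.
Local Notation b := (vbasis {:V}).
Local Notation idx := ('I_n * 'I_(\dim {:V}))%type.

Definition hom_basis (p : idx) : W := A p.1 b`_p.2.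

Lemma hom_coord i (v : V) (a : R) :
  A i (a *: v) = \sum_(k < \dim {:V}) (a * coord b k v) *: A i b`_k.
Proof.
rewrite {1}(coord_vbasis (memvf v)) scaler_sumr linear_sum.
by apply: eq_bigr => k _; rewrite scalerA linearZ.
Qed.

Lemma diff_op_lincomb :
  diff_op A phi = lincomb (fun p => 'D_(e_ p.1) (comp_coord p.2 phi)) hom_basis.
Proof.
have [phis _] := phi_test; apply/funext => x; rewrite /diff_op /lincomb.
rewrite -(pair_bigA _ (fun i k => 'D_(e_ i) (comp_coord k phi) x *: A i b`_k)) /=.
apply: eq_bigr => i _; rewrite -[X in A i X]scale1r hom_coord.
by apply: eq_bigr => k _; rewrite mul1r (coord_derive k ((phis [::]).2 i x)).2.
Qed.

Lemma symbol_lincomb (rho : 'rV[R]_n -> R) x :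
  (fun xi => rho xi *: symbol A ((enorm xi)^-1 *: xi)
     ((enorm xi)^-1 *: (phi (x + xi) - phi x))) =
  lincomb (fun p => kern rho p.1 (increment (comp_coord p.2 phi) x)) hom_basis.
Proof.
apply/funext => xi; rewrite /symbol /lincomb.
rewrite -(pair_bigA _ (fun i k => kern rho i (increment (comp_coord k phi) x) xi *: A i b`_k)) /=.
rewrite sum_lfunE scaler_sumr; apply: eq_bigr => i _.
rewrite scale_lfunE hom_coord !scaler_sumr; apply: eq_bigr => k _.
rewrite !scalerA /kern /dir /increment /comp_coord linearB mxE; congr (_ *: _); ring.
Qed.

Lemma nonlocal_op_lincomb (rho : 'rV[R]_n -> R) :
  mu.-integrable setT (EFin \o rho) -> (forall x, 0 <= rho x) ->
  nonlocal_op A rho phi =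
  lincomb (fun p => nonlocal_partial rho p.1 (comp_coord p.2 phi)) hom_basis.
Proof.
move=> irho rho0; apply/funext => x; apply: cvg_lim; first exact: norm_hausdorff.
have sF (p : idx) : sublinear (increment (comp_coord p.2 phi) x).
  by apply: sublinear_increment; exact: bsmooth_coord.
rewrite (_ : nonlocal_trunc A rho phi x = fun delta => \sum_p
   (n%:R * \int[mu]_(xi in ~` eball delta)
       kern rho p.1 (increment (comp_coord p.2 phi) x) xi) *: hom_basis p); last first.
  apply/funext => delta; rewrite /nonlocal_trunc symbol_lincomb.
  have mD : measurable (~` @eball R n delta) by apply: measurableC; exact: measurable_eball.
  rewrite vintegral_lincomb//.
    by rewrite scaler_sumr; apply: eq_bigr => p _; rewrite scalerA.
  by move=> p; apply: (integrableS measurableT) => //; exact: integrable_kern.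
apply: cvg_big => [|p _]; first exact: add_continuous.
by apply: cvgZr_tmp; apply: cvgMl_tmp; exact: truncated_kern_cvg.
Qed.

End operators_in_coordinates.

(** * Supports and convergence *)

Section supports.
Context {R : realType} {n : nat}.
Local Notation mu := (lebesgue_rV R n).

Lemma cube_closed_cube r t (x : 'rV[R]_n) : r <= t -> cube 0 r x -> closed_cube t x.
Proof.
move=> rt xr i; have := xr i; rewrite /ball/= mxE sub0r normrN in_itv/= => xi.
by rewrite -ler_norml (le_trans (ltW xi)).
Qed.

(** If [x + xi] is in the cube of half-side [r] and [xi] in the one of half-side
    [t], then [x] is in the one of half-side [r + t]. *)
Lemma nonlocal_partial_supp (rho f : 'rV[R]_n -> R) i r t x :
  0 <= r -> 0 <= t ->
  (forall xi, ~ cube 0 t xi -> rho xi = 0) -> (forall x, ~ cube 0 r x -> f x = 0) ->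
  ~ closed_cube (r + t) x -> nonlocal_partial rho i f x = 0.
Proof.
move=> r0 t0 rhot fr nx; rewrite /nonlocal_partial /avg.
under eq_Rintegral => xi _.
  rewrite (_ : kern _ _ _ _ = 0).
    over.
  rewrite /kern; have [xit|/rhot ->] := pselect (cube 0 t xi); last by rewrite mul0r.
  rewrite /increment !fr ?subrr ?mulr0// => h; apply: nx.
    by apply: cube_closed_cube h; rewrite lerDl.
  move=> j; have := h j; have := xit j; rewrite /ball/= !mxE !sub0r !normrN => xij xxij.
  rewrite in_itv/= -ler_norml -[x 0 j](addrK (xi 0 j)).
  by rewrite (le_trans (ler_normB _ _))// lerD// ltW.
by rewrite Rintegral_cst// mul0r mulr0.
Qed.

(** There are finitely many words of length at most [N] over a finite alphabet, so
    finitely many eventual properties hold simultaneously. *)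
Lemma near_bounded_size (F : set_system R) (Q : seq 'I_n -> R -> Prop) N :
  Filter F -> (forall s, \forall eps \near F, Q s eps) ->
  \forall eps \near F, forall s, (size s <= N)%N -> Q s eps.
Proof.
move=> FF; elim: N Q => [|N IHN] Q nQ.
  by apply: filterS (nQ [::]) => eps Q0 s; rewrite leqn0 size_eq0 => /eqP ->.
have := filter_forall FF (fun i => IHN (fun s => Q (i :: s)) (fun s => nQ (i :: s))).
apply: filterS2 (nQ [::]) => eps Q0 QS [|i s]//= sN.
by apply: QS; rewrite -ltnS.
Qed.

End supports.

Theorem lemma2p11 (R : realType) (n : nat) (n_gt0 : (0 < n)%N)
  (V W : finInnerType R) (A : 'I_n -> 'Hom(V, W))
  (rho : R -> 'rV[R]_n -> R)
  (rho_L1 : forall eps, 0 < eps ->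
    (lebesgue_rV R n).-integrable setT (EFin \o rho eps))
  (rho_ge0 : forall eps x, 0 < eps -> 0 <= rho eps x)
  (rho_radial : forall eps, 0 < eps -> radial (rho eps))
  (rho_norm1 : forall eps, 0 < eps -> L1norm setT (rho eps) = 1%E)
  (rho_concentrates : forall delta, 0 < delta ->
    L1norm (~` eball delta) (rho eps) @[eps --> 0^'+] --> 0%E)
  (p : \bar R) (p_ge1 : (1 <= p)%E)
  (phi : 'rV[R]_n -> V) (phi_test : test_function phi) :
  cvg_Lp p (fun eps => nonlocal_op A (rho eps) phi) (diff_op A phi) /\
  (uniformly_compactly_supported rho ->
    cvg_test (fun eps => nonlocal_op A (rho eps) phi) (diff_op A phi)).
Proof.
pose idx := ('I_n * 'I_(\dim {:V}))%type.
pose f (q : idx) := comp_coord q.2 phi.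
pose d (q : idx) := 'D_(delta_mx 0 q.1 : 'rV[R]_n) (f q).
pose T eps (q : idx) := nonlocal_partial (rho eps) q.1 (f q).
pose err eps (q : idx) x := T eps q x - d q x.
pose w := hom_basis A.
have fs q : bsmooth (f q) by exact: bsmooth_coord.
have ds q : bsmooth (d q) by apply: (bsmooth_partial q.1 (fs q)).
have rho1 eps : 0 < eps -> \int[lebesgue_rV R n]_x rho eps x = 1.
  move=> eps0; have := rho_norm1 _ eps0; rewrite /L1norm /Rintegral => /(congr1 fine) /= <-.
  by congr fine; apply: eq_integral => x _; rewrite ger0_norm// rho_ge0.
have rho0 eps : 0 < eps -> forall x, 0 <= rho eps x by move=> eps0 x; exact: rho_ge0.
have Ts eps q : 0 < eps -> bsmooth (T eps q).
  move=> eps0.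
  exact: (bsmooth_nonlocal_partial (rho_L1 _ eps0) (rho0 _ eps0) (rho1 _ eps0) q.1 (fs q)).
have errs eps q : 0 < eps -> bsmooth (err eps q).
  by move=> eps0; apply: (@bsmoothB _ _ (T eps q) (d q)) => //; exact: Ts.
have opE eps : 0 < eps -> nonlocal_op A (rho eps) phi = lincomb (T eps) w.
  by move=> eps0; rewrite nonlocal_op_lincomb//; [exact: rho_L1|exact: rho0].
have dE : diff_op A phi = lincomb d w by rewrite diff_op_lincomb.
have errE eps : 0 < eps ->
    (fun x => nonlocal_op A (rho eps) phi x - diff_op A phi x) = lincomb (err eps) w.
  move=> eps0; rewrite opE// dE; apply/funext => x.
  by rewrite /lincomb -sumrB; apply: eq_bigr => q _; rewrite -scalerBl.
have [r r0 phir] := compact_in_cube phi_test.2.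
have f0 s q x : ~ cube 0 r x -> pderivs s (f q) x = 0 by exact: coord_supp.
(* Uniform remainder bounds, one for each coordinate and each derivative. *)
have /choice[BM BMP] : forall qs : idx * seq 'I_n, exists BM : R * R,
    [/\ 0 <= BM.1, 0 <= BM.2 & forall x xi,
    (enorm xi)^-1 * `|remainder (pderivs qs.2 (f qs.1)) x xi| <= modulus BM xi].
  move=> [q s]; have [BM [B0 M0] BMP] := remainder_bound (bsmooth_pderivs s (fs q)).
  by exists BM.
pose m eps s q := n%:R * mean_modulus (rho eps) (BM (q, s)).
have m0 eps s q : 0 < eps -> 0 <= m eps s q.
  move=> eps0; have [B0 M0 _] := BMP (q, s).
  by rewrite mulr_ge0// mean_modulus_ge0//; exact: rho0.
have mcvg s : \sum_q m eps s q * `|w q| @[eps --> 0^'+] --> (0 : R).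
  rewrite [X in _ --> X](_ : 0 = \sum_(q : idx) n%:R * 0 * `|w q|); last first.
    by rewrite big1// => q _; rewrite mulr0 mul0r.
  apply: cvg_big => [|q _]; first exact: add_continuous.
  apply: cvgMr_tmp; apply: cvgMl_tmp; have [B0 M0 _] := BMP (q, s).
  exact: mean_modulus_cvg0.
(* Total volume of the two cubes of [error_L1]; [K] is kept at least 1 for
   [Lnorm_le]. *)
pose V0 : R := 2 * (r *+ 2) ^+ n.
pose K := Num.max 1 V0.
have K1 : 1 <= K by rewrite le_max lexx.
have derrE eps s q : 0 < eps -> pderivs s (err eps q) =
    (fun x => nonlocal_partial (rho eps) q.1 (pderivs s (f q)) x -
       'D_(delta_mx 0 q.1 : 'rV[R]_n) (pderivs s (f q)) x).
  move=> eps0; rewrite (pderivsB s (Ts _ q eps0) (ds q)) pderivs_partial//.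
  by rewrite (pderivs_nonlocal_partial (rho_L1 _ eps0) (rho0 _ eps0) (rho1 _ eps0)).
have err_sup eps s q x : 0 < eps -> `|pderivs s (err eps q) x| <= m eps s q.
  move=> eps0; rewrite derrE//; have [B0 M0 BMx] := BMP (q, s).
  apply: error_sup => //; [exact: rho_L1|exact: rho0|exact: rho1|exact: rho_radial|].
  exact: bsmooth_pderivs.
have err_L1 eps q : 0 < eps ->
    (\int[lebesgue_rV R n]_x `|err eps q x|%:E <= (m eps [::] q * K)%:E)%E.
  move=> eps0; have [B0 M0 BMx] := BMP (q, [::]).
  apply: (@le_trans _ _ (m eps [::] q * V0)%:E).
    apply: error_L1 => //; [exact: rho_L1|exact: rho0|exact: rho1|exact: rho_radial| |].
      by move=> x nx; exact: (f0 [::]).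
    by move=> j x nx; exact: (f0 [:: j]).
  by rewrite lee_fin ler_wpM2l ?m0// le_max lexx orbT.
have /choice[B dB] : forall q, exists B, 0 <= B /\ forall x, `|d q x| <= B.
  by move=> q; have [B] := bsmooth_bounded (ds q); exists B.
have d_L1 q : (\int[lebesgue_rV R n]_x `|d q x|%:E <= (B q * K)%:E)%E.
  have [B0 dBq] := dB q.
  apply: le_trans (L1_le_cube (bsmooth_continuous (ds q)) B0 r0 dBq _) _.
    by move=> x; exact: (f0 [:: q.1]).
  rewrite lee_fin ler_wpM2l// le_max /V0 ler_peMl ?orbT// ?ler1n// exprn_ge0//.
  exact: mulrn_wge0.
have Lp_lincomb (g : idx -> 'rV[R]_n -> R) (c : idx -> R) :
    (forall q, bsmooth (g q)) -> (forall q, 0 <= c q) ->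
    (forall q x, `|g q x| <= c q) ->
    (forall q, (\int[lebesgue_rV R n]_x `|g q x|%:E <= (c q * K)%:E)%E) ->
    in_Lp p (lincomb g w).
  move=> gs c0 gc gi; have gcont q := bsmooth_continuous (gs q); split.
    move=> U oU; apply: open_measurable_rV.
    by move/continuousP: (continuous_lincomb (w := w) gcont); exact.
  by apply: (le_lt_trans (vLnorm_lincomb w p_ge1 K1 gcont c0 gc gi)); rewrite ltry.
split.
  split.
  - move=> eps eps0; rewrite opE//.
    apply: (Lp_lincomb _ (fun q => m eps [::] q + B q)).
    + by move=> q; exact: Ts.
    + by move=> q; rewrite addr_ge0 ?m0//; case: (dB q).
    + move=> q x; rewrite -[T eps q x](subrK (d q x)) (le_trans (ler_normD _ _))//.
      apply: lerD; first exact: (err_sup _ [::]).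
      by case: (dB q).
    + move=> q.
      have me (g : 'rV[R]_n -> R) : bsmooth g -> measurable_fun setT (fun x => `|g x|%:E).
        move=> gs; apply/measurable_EFinP; apply: measurableT_comp => //.
        exact: (continuous_measurable_rV (bsmooth_continuous gs)).
      apply: (@le_trans _ _ (\int[lebesgue_rV R n]_x (`|err eps q x|%:E + `|d q x|%:E))%E).
        apply: ge0_le_integral => //.
        * by apply: me; exact: Ts.
        * by apply: emeasurable_funD; apply: me; [exact: errs|exact: ds].
        * move=> x _; rewrite -EFinD lee_fin -[T eps q x](subrK (d q x)).
          exact: ler_normD.
      rewrite ge0_integralD//; last 2 first.
      * by apply: me; exact: errs.
      * by apply: me; exact: ds.
      by rewrite mulrDl EFinD leeD// err_L1.
  - rewrite dE; apply: (Lp_lincomb _ B) => // q; first by case: (dB q).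
    by move=> x; case: (dB q).
  - apply: (@squeeze_cvge _ _ _ _ (cst 0%E) _
      (fun eps => ((\sum_q m eps [::] q * `|w q|) * K)%:E)).
    + near=> eps; have eps0 : 0 < eps by [].
      rewrite errE//; apply/andP; split; first exact: Lnorm_ge0.
      apply: vLnorm_lincomb => //.
      * by move=> q; apply: bsmooth_continuous; exact: errs.
      * by move=> q; exact: m0.
      * by move=> q x; exact: (err_sup _ [::]).
      * by move=> q; exact: err_L1.
    + exact: cvg_cst.
    + apply: cvg_EFin; first exact: nearW.
      rewrite [X in _ --> X](_ : 0 = 0 * K); last by rewrite mul0r.
      by apply: cvgMr_tmp; exact: mcvg.
move=> [Kr cKr rhoKr].
have [t t0 Krt] := compact_in_cube cKr.
have d0 q x : ~ closed_cube (r + t) x -> d q x = 0.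
  move=> nx; apply: (f0 [:: q.1]) => xr; apply: nx.
  by apply: cube_closed_cube xr; rewrite lerDl.
have T0 eps q x : 0 < eps -> ~ closed_cube (r + t) x -> T eps q x = 0.
  move=> eps0; apply: nonlocal_partial_supp => //; last by move=> y; exact: (f0 [::]).
  by move=> xi nxi; apply: rhoKr => // /Krt.
split.
- move=> eps eps0; rewrite opE//; apply: (test_function_lincomb _ _ _).1 => q.
    exact: Ts.
  by move=> x; exact: T0.
- by rewrite dE; exact: (test_function_lincomb w ds d0).1.
move=> U [_ _ _ /(_ _ (@closed_cube_compact R n (r + t)))[N [e [e0 UP]]]].
have near_s s : \forall eps \near (0 : R)^'+, \sum_q m eps s q * `|w q| <= e.
  have /cvgrPdist_le/(_ _ e0) := mcvg s; apply: filterS => eps.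
  by rewrite sub0r normrN; exact: le_trans (ler_norm _).
have near_N := near_bounded_size N _ near_s.
near=> eps; have eps0 : 0 < eps by [].
rewrite (_ : _ - _ = lincomb (err eps) w); last by rewrite -errE.
apply: UP.
  apply: test_function_lincomb => [q|q x nx]; first exact: errs.
  by rewrite /err T0// d0// subrr.
move=> s x sN; rewrite iter_partial_lincomb; last by move=> q; exact: errs.
apply: (@le_trans _ _ (\sum_q m eps s q * `|w q|)).
  rewrite (le_trans (ler_norm_sum _ _ _))// ler_sum// => q _.
  by rewrite normrZ ler_wpM2r// err_sup.
by move: s sN {x}; near: eps; exact: near_N.
Unshelve. all: by end_near. Qed.
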